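(* Let $T_3$ denote the infinite $3$-regular tree and let $\mathbb{Z}^2$ denote the $2$-dimensional integer lattice graph. For every integer $k\geq 1$, \[ \mathrm{wir}^k_{T_3\to\mathbb{Z}^2}(n)\simeq n . \]
   Context: Graphs are regarded as topological spaces ($1$-dimensional complexes); $|\Gamma|$ is the number of vertices of $\Gamma$, and $V\Gamma$, $E\Gamma$ are its vertex and edge sets. $\mathbb{Z}^2$ is the graph with vertex set $\mathbb{Z}\times\mathbb{Z}$ in which vertices at Euclidean distance $1$ are adjacent. Wiring: a wiring of a graph $\Gamma$ into a graph $\Gamma'$ is a continuous map $f:\Gamma\to\Gamma'$ which maps vertices to vertices and edges to unions of edges. It is a coarse $k$-wiring if (1) the restriction of $f$ to $V\Gamma$ is at most $k$-to-$1$, i.e. $|\{v\in V\Gamma : f(v)=w\}|\leq k$ for all $w\in V\Gamma'$; and (2) each edge $e\in E\Gamma'$ is contained in at most $k$ of the image paths of $f$ (images of edges of $\Gamma$). The volume $\mathrm{vol}(f)$ is the number of vertices in the image of $f$. Wiring profile: for a finite graph $\Gamma$ and a graph $Y$, $\mathrm{wir}^k(\Gamma\to Y)$ is the minimal volume of a coarse $k$-wiring of $\Gamma$ into $Y$, or $\infty$ if none exists. For graphs $X,Y$, $\mathrm{wir}^k_{X\to Y}(n)=\max\{\mathrm{wir}^k(\Gamma\to Y) : \Gamma\leq X,\ |\Gamma|\leq n\}$, where $\Gamma\leq X$ means $\Gamma$ is a subgraph of $X$. Comparison: for functions $f,g$ on $\mathbb{N}$, $f\lesssim g$ means there is a constant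 $C$ such that $f(n)\leq Cg(Cn)+C$ for all $n$; $f\simeq g$ means $f\lesssim g$ and $g\lesssim f$. In ''$\simeq n$'' the right-hand side is the function $n\mapsto n$. *)

(* Defs.v *)
From HB Require Import structures.
From mathcomp Require Import all_boot all_order all_algebra.
From mathcomp Require Import all_classical all_reals all_analysis.
Import Order.TTheory GRing.Theory Num.Theory.
Import numFieldNormedType.Exports.

Set Implicit Arguments.
Unset Strict Implicit.
Unset Printing Implicit Defensive.

Local Open Scope classical_set_scope.
Local Open Scope card_scope.
Local Open Scope ring_scope.

(* The vertices form a subset of an ambient type, so that a graph and its
   subgraphs live over the same type. *)
Record graph (V : Type) := Graph {
  vertices : set V;
  adj : V -> V -> Prop;
  adj_sym : forall u v, adj u v -> adj v u;
  adj_irrefl : forall v, ~ adj v v;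
  adj_vertices : forall u v, adj u v -> vertices u }.

Definition edges (V : Type) (G : graph V) : set (set V) :=
  [set e | exists u v, adj G u v /\ e = [set u; v]].

Definition subgraph (V : Type) (G X : graph V) : Prop :=
  vertices G `<=` vertices X /\ (forall u v, adj G u v -> adj X u v).

(** * The 1-dimensional complex of a graph *)

Section Realization.
Variables (R : realType) (V : Type) (G : graph V).

(* Barycentric coordinates: the vertex v is the indicator function of {v}, and
   the edge {u, v} is the segment joining the vertices u and v. *)
Definition segment (u v : V) (t : R) : V -> R :=
  fun w => (1 - t) * \1_[set u] w + t * \1_[set v] w.

Definition is_point (x : V -> R) : Prop :=
  (exists2 v, vertices G v & x = \1_[set v]) \/
  (exists u v t, [/\ adj G u v, 0 <= t <= 1 & x = segment u v t]).

Record realization := Point {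
  point_coord : V -> R;
  point_coordP : is_point point_coord }.

HB.instance Definition _ := gen_eqMixin realization.
HB.instance Definition _ := gen_choiceMixin realization.

Definition clamp (t : R) : R := Num.max 0 (Num.min t 1).

Fact edge_point_subproof u v (h : adj G u v) t :
  is_point (segment u v (clamp t)).
Proof.
right; exists u, v, (clamp t); split=> //.
by rewrite /clamp le_max lexx ge_max ler01 ge_min lexx orbT.
Qed.

(* The characteristic map of the edge {u, v}, extended to R by precomposition
   with the retraction of R onto [0, 1]. *)
Definition edge_point u v (h : adj G u v) (t : R) : realization :=
  Point (edge_point_subproof h t).

(* The weak (CW) topology: a set is open when its preimage under every
   characteristic map is open. As [clamp] is a retraction, it is equivalent to
   ask for an open subset of R or for a relatively open subset of [0, 1]. *)
Definition complex_open (U : set realization) : Prop :=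
  forall u v (h : adj G u v), open (edge_point h @^-1` U).

Fact complex_openT : complex_open setT.
Proof. by move=> u v h; rewrite preimage_setT; exact: openT. Qed.

Fact complex_openI : setI_closed complex_open.
Proof.
by move=> A B oA oB u v h; rewrite preimage_setI; exact: openI (oA _ _ h) _.
Qed.

Fact complex_open_bigU (I : Type) (f : I -> set realization) :
  (forall i, complex_open (f i)) -> complex_open (\bigcup_i f i).
Proof.
move=> of_ u v h; rewrite preimage_bigcup.
by apply: bigcup_open => i _; exact: of_.
Qed.

HB.instance Definition _ := @isOpenTopological.Build realization
  complex_open complex_openT complex_openI complex_open_bigU.

Definition vertex_points : set realization :=
  [set x | exists2 v, vertices G v & point_coord x = \1_[set v]].

(* For an edge e, the points of the complex supported in e are exactly those of
   the closed edge. *)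
Definition closed_edge (e : set V) : set realization :=
  [set x | forall w, point_coord x w != 0 -> e w].

End Realization.

Arguments realization : clear implicits.
Arguments vertex_points : clear implicits.
Arguments closed_edge : clear implicits.

(** * Wirings *)

Section Wiring.
Variables (R : realType) (V W : Type) (G : graph V) (Y : graph W).

Definition wiring (f : realization R V G -> realization R W Y) : Prop :=
  [/\ continuous f,
      f @` vertex_points R V G `<=` vertex_points R W Y
    & forall e, edges G e ->
        exists2 F : set (set W), F `<=` edges Y &
          f @` closed_edge R V G e = \bigcup_(e' in F) closed_edge R W Y e'].

Definition coarse_wiring (k : nat)
    (f : realization R V G -> realization R W Y) : Prop :=
  [/\ wiring f,
      forall y, vertex_points R W Y y ->
        [set x | vertex_points R V G x /\ f x = y] #<= `I_k
    & forall e', edges Y e' ->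
        [set e | edges G e /\
                 closed_edge R W Y e' `<=` f @` closed_edge R V G e] #<= `I_k].

Definition volume (f : realization R V G -> realization R W Y) : \bar R :=
  counting (range f `&` vertex_points R W Y).

(* Volumes are natural numbers or +oo, so the infimum is a minimum, and it is
   +oo when there is no coarse k-wiring. *)
Definition wir (k : nat) : \bar R :=
  ereal_inf [set volume f | f in [set f | coarse_wiring k f]].

End Wiring.

Arguments wir R {V W} G Y k.

(* There are finitely many isomorphism types of graphs with at most n vertices,
   so the supremum is a maximum. *)
Definition wiring_profile (R : realType) (V W : Type) (X : graph V)
    (Y : graph W) (k n : nat) : \bar R :=
  ereal_sup [set wir R G Y k |
    G in [set G : graph V | subgraph G X /\ vertices G #<= `I_n]].

(* C is a natural number because C * n has to be an argument of g. *)
Definition asymp_le (R : realType) (f g : nat -> \bar R) : Prop :=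
  exists C : nat, forall n : nat,
    (f n <= C%:R%:E * g (C * n)%N + C%:R%:E)%E.

Definition asymp_eq (R : realType) (f g : nat -> \bar R) : Prop :=
  asymp_le f g /\ asymp_le g f.

(** * The 3-regular tree and the square lattice *)

(* The tree is the Cayley graph of the free product of three groups of order 2:
   its vertices are the words in three letters in which consecutive letters are
   distinct, and w is adjacent to a :: w. *)
Definition reduced (w : seq 'I_3) : bool := sorted (fun a b => a != b) w.

Definition T3_adj : rel (seq 'I_3) := fun u v =>
  [&& reduced u, reduced v &
      [exists a, v == a :: u] || [exists a, u == a :: v]].

Fact T3_adj_sym u v : T3_adj u v -> T3_adj v u.
Proof. by rewrite /T3_adj => /and3P[-> -> /=]; rewrite orbC. Qed.

Fact T3_adj_irrefl v : ~ T3_adj v v.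
Proof.
by case/and3P=> _ _ /orP[] /existsP[a /eqP/(congr1 size)/n_Sn].
Qed.

Fact T3_adj_reduced u v : T3_adj u v -> reduced u.
Proof. by case/and3P. Qed.

Definition T3 : graph (seq 'I_3) :=
  @Graph _ [set w | reduced w] T3_adj T3_adj_sym T3_adj_irrefl T3_adj_reduced.

(* Euclidean distance 1, written with the squared distance. *)
Definition Z2_adj (p q : int * int) : Prop :=
  (p.1 - q.1) ^+ 2 + (p.2 - q.2) ^+ 2 = 1.

Fact Z2_adj_sym p q : Z2_adj p q -> Z2_adj q p.
Proof. by rewrite /Z2_adj -(opprB p.1) -(opprB p.2) !sqrrN. Qed.

Fact Z2_adj_irrefl p : ~ Z2_adj p p.
Proof. by rewrite /Z2_adj !subrr. Qed.

Definition Z2 : graph (int * int) :=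
  @Graph _ setT Z2_adj Z2_adj_sym Z2_adj_irrefl (fun _ _ _ => I).

(* Main.v *)
Require Import Defs.
From mathcomp Require Import all_boot all_order all_algebra.
From mathcomp Require Import all_classical all_reals all_analysis.
From mathcomp Require Import zify lra ring.

Set Implicit Arguments.
Unset Strict Implicit.
Unset Printing Implicit Defensive.

Import Order.TTheory GRing.Theory Num.Theory.
Import numFieldNormedType.Exports.

Local Open Scope ring_scope.

(** Upper bound.  A subgraph of T_3 with n vertices is a forest, and it suffices
    to draw it in the lattice with straight, pairwise disjoint wires of total
    length O(n).  A rooted tree is drawn in a box [0, a] x [0, b] with its root
    at the origin, by recursion on its (at most two) principal subtrees, so that
    len + a + 2 b is at most three times the number of non-root vertices.  One
    of the two subtrees can be transposed above the root when its width is at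
    most twice the height of the other one; otherwise both subtrees are wide and
    the gain on the width pays for stacking them.  The third subtree at the
    root of T_3 is drawn mirrored, and the components of the forest are
    placed side by side.  The drawing, extended affinely, is a coarse 1-wiring:
    the wires without their starting points are disjoint, so that two wires
    could cover the same lattice edge only in opposite directions, and then each
    of the two vertices they lead to would be the parent of the other.

    Lower bound.  A coarse k-wiring of an edgeless graph with n vertices has
    volume at least n / k. *)

(** * Drawings of rooted forests in the lattice by half-open wires *)

Definition between (a b c : int) := (a <= c <= b) || (b <= c <= a).

(** For [aligned] points the box degenerates to the lattice segment that joins them. *)
Definition box (p q r : int * int) :=
  between p.1 q.1 r.1 && between p.2 q.2 r.2.

Definition aligned (p q : int * int) := (p.1 == q.1) || (p.2 == q.2).

Definition dist1 (p q : int * int) : nat :=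
  (`|p.1 - q.1| + `|p.2 - q.2|)%N.

Section Drawing.
Variables (V : eqType) (par : V -> V).
Implicit Types (E : pred V) (s t : seq V) (phi : V -> int * int).

(* E is the set of the vertices that are joined to their parents; the wire of
   such a vertex is half-open, so that wires can be required to be disjoint. *)
Definition wire E phi v : pred (int * int) := fun q =>
  if E v then box (phi (par v)) (phi v) q && (q != phi (par v)) else q == phi v.

(** Since [phi v] itself lies on the wire of [v], disjointness expresses at once that [phi] is
    injective, that wires do not cross, and that no wire passes through a foreign vertex. *)
Record drawing E s phi : Prop := Drawing {
  drawing_par : forall v, v \in s -> E v -> par v \in s;
  drawing_neq : forall v, v \in s -> E v -> phi (par v) != phi v;
  drawing_aligned : forall v, v \in s -> E v -> aligned (phi (par v)) (phi v);
  drawing_disjoint : forall u v q, u \in s -> v \in s ->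
    wire E phi u q -> wire E phi v q -> u = v }.

Definition wire_length E s phi : nat :=
  \sum_(v <- s | E v) dist1 (phi (par v)) (phi v).

Definition drawn_in (B : pred (int * int)) E s phi :=
  forall v q, v \in s -> wire E phi v q -> B q.

Lemma wire_end E s phi v : drawing E s phi -> v \in s -> wire E phi v (phi v).
Proof.
move=> D sv; rewrite /wire; case: ifP => // Ev.
by rewrite eq_sym (drawing_neq D) // andbT /box /between; lia.
Qed.

Lemma eq_wire E E' phi phi' v q : E v = E' v -> phi v = phi' v ->
  (E v -> phi (par v) = phi' (par v)) -> wire E phi v q = wire E' phi' v q.
Proof.
rewrite /wire => <- ->; case: ifP => // _ -> //.
Qed.

Lemma eq_drawing E E' s s' phi phi' : s =i s' -> {in s, E =1 E'} ->
  {in s, phi =1 phi'} -> drawing E s phi -> drawing E' s' phi'.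
Proof.
move=> ss EE pp D.
have W u q : u \in s -> wire E' phi' u q = wire E phi u q.
  move=> su; apply/esym/eq_wire => [||Eu]; [exact: EE|exact: pp|].
  exact/pp/(drawing_par D).
split=> [v|v|v|u v q]; rewrite -!ss => sv; rewrite -?EE //.
- exact: (drawing_par D).
- by move=> Ev; rewrite -!pp ?(drawing_neq D)// (drawing_par D).
- by move=> Ev; rewrite -!pp ?(drawing_aligned D)// (drawing_par D).
by move=> sv'; rewrite !W//; exact: (drawing_disjoint D).
Qed.

Lemma eq_drawn_in B E E' s s' phi phi' : s =i s' -> {in s, E =1 E'} ->
  {in s, phi =1 phi'} -> drawing E s phi -> drawn_in B E s phi ->
  drawn_in B E' s' phi'.
Proof.
move=> ss EE pp D H v q; rewrite -ss => sv Hw; apply: (H v) => //.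
rewrite (eq_wire (E' := E') (phi' := phi')) //; first exact: EE.
  exact: pp.
by move=> Ev; apply/pp/(drawing_par D).
Qed.

Lemma eq_wire_length E E' s s' phi phi' : perm_eq s s' -> {in s, E =1 E'} ->
  {in s, phi =1 phi'} -> drawing E s phi ->
  wire_length E' s' phi' = wire_length E s phi.
Proof.
move=> ss EE pp D; rewrite /wire_length -(perm_big _ ss) big_seq_cond.
rewrite [RHS]big_seq_cond; apply: eq_big => v; case sv: (v \in s) => //=.
  by rewrite EE.
by rewrite -EE// => Ev; rewrite !pp ?(drawing_par D).
Qed.

Lemma drawing_cat E s t phi : drawing E s phi -> drawing E t phi ->
  (forall u v q, u \in s -> v \in t -> wire E phi u q -> wire E phi v q -> u = v) ->
  drawing E (s ++ t) phi.
Proof.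
move=> Ds Dt H.
split=> [v|v|v|u v q]; rewrite ?mem_cat.
- case/orP=> sv Ev; apply/orP;
  by [left; apply: (drawing_par Ds)|right; apply: (drawing_par Dt)].
- by case/orP=> sv; [apply: (drawing_neq Ds)|apply: (drawing_neq Dt)].
- by case/orP=> sv; [apply: (drawing_aligned Ds)|apply: (drawing_aligned Dt)].
case/orP=> su; case/orP=> sv wu wv.
- exact: (drawing_disjoint Ds) wu wv.
- exact: H wu wv.
- by apply/esym; apply: H wv wu.
- exact: (drawing_disjoint Dt) wu wv.
Qed.

Lemma drawing_cat_box (B C : pred (int * int)) E s t phi :
  drawing E s phi -> drawing E t phi -> drawn_in B E s phi ->
  drawn_in C E t phi -> (forall q, B q -> C q -> false) -> drawing E (s ++ t) phi.
Proof.
move=> Ds Dt Bs Ct BC; apply: drawing_cat => // u v q su tv wu wv.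
by have := BC q (Bs u q su wu) (Ct v q tv wv).
Qed.

(** A root [x] becomes a child of [par x]. The other wires may meet the closed segment only at its
    starting point, which the new half-open wire leaves out. *)
Lemma drawing_link E s phi x : drawing E s phi -> x \in s -> ~~ E x ->
  par x \in s -> aligned (phi (par x)) (phi x) -> phi (par x) != phi x ->
  (forall v q, v \in s -> v != x -> wire E phi v q ->
     box (phi (par x)) (phi x) q -> q = phi (par x)) ->
  drawing (predU1 x E) s phi.
Proof.
move=> D sx nEx spx al nz H.
have W v q : v != x -> wire (predU1 x E) phi v q = wire E phi v q.
  by move=> vx; apply: eq_wire => //=; rewrite (negbTE vx).
have Wx q : wire (predU1 x E) phi x q =
    box (phi (par x)) (phi x) q && (q != phi (par x)).
  by rewrite /wire /= eqxx.
split=> [v|v|v|u v q] sv /=.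
- by case: eqP => [->|] //= _; apply: (drawing_par D).
- by case: eqP => [->|] //= _; apply: (drawing_neq D).
- by case: eqP => [->|] //= _; apply: (drawing_aligned D).
have [->|ux] := eqVneq u x; have [->|vx] := eqVneq v x => // sv'.
- by rewrite Wx W// => /andP[b n] w; rewrite (H v q) ?eqxx in n.
- by rewrite Wx W// => w /andP[b n]; rewrite (H u q) ?eqxx in n.
by rewrite !W//; exact: (drawing_disjoint D).
Qed.

Lemma drawing1 E v phi : ~~ E v -> drawing E [:: v] phi.
Proof.
move=> nE; split=> [u|u|u|u u' q]; rewrite ?inE => /eqP->; rewrite ?(negbTE nE)//.
by move/eqP->.
Qed.

Lemma wire_length_cat E s t phi :
  wire_length E (s ++ t) phi = (wire_length E s phi + wire_length E t phi)%N.
Proof. exact: big_cat. Qed.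

Lemma wire_length1 E v phi : ~~ E v -> wire_length E [:: v] phi = 0%N.
Proof. by rewrite /wire_length big_cons big_nil => /negbTE->. Qed.

Lemma wire_length_link E s phi x : uniq s -> x \in s -> ~~ E x ->
  wire_length (predU1 x E) s phi =
  (dist1 (phi (par x)) (phi x) + wire_length E s phi)%N.
Proof.
move=> us sx nE; rewrite /wire_length !(perm_big _ (perm_to_rem sx)).
rewrite !big_cons /= eqxx (negbTE nE) /=; congr addn.
rewrite big_seq_cond [RHS]big_seq_cond; apply: eq_bigl => v.
by rewrite mem_rem_uniq// !inE; case: eqP.
Qed.

End Drawing.

(** * Moving drawings by lattice isometries *)

Section DrawingIsometry.
Variables (V : eqType) (par : V -> V) (g h : int * int -> int * int).
Hypotheses (gK : cancel g h) (hK : cancel h g).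
Hypothesis box_g : forall p q r, box (g p) (g q) (g r) = box p q r.
Hypothesis aligned_g : forall p q, aligned (g p) (g q) = aligned p q.
Hypothesis dist1_g : forall p q, dist1 (g p) (g q) = dist1 p q.

Lemma wire_isometry E phi v q : wire par E (g \o phi) v q = wire par E phi v (h q).
Proof.
rewrite /wire -{1 2 3}(hK q) /= box_g !(inj_eq (can_inj gK)).
by case: ifP.
Qed.

Lemma drawing_isometry E s phi : drawing par E s phi -> drawing par E s (g \o phi).
Proof.
move=> D; split=> [v|v|v|u v q] sv /=.
- exact: (drawing_par D).
- by rewrite (inj_eq (can_inj gK)); apply: (drawing_neq D).
- by rewrite aligned_g; apply: (drawing_aligned D).
by move=> sv'; rewrite !wire_isometry; apply: (drawing_disjoint D).
Qed.

Lemma drawn_in_isometry B E s phi : drawn_in par B E s phi ->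
  drawn_in par (B \o h) E s (g \o phi).
Proof. by move=> H v q sv; rewrite wire_isometry; apply: H. Qed.

Lemma wire_length_isometry E s phi :
  wire_length par E s (g \o phi) = wire_length par E s phi.
Proof. by apply: eq_bigr => v _; apply: dist1_g. Qed.

End DrawingIsometry.

Definition shift (d p : int * int) : int * int := (d.1 + p.1, d.2 + p.2).
Definition transpose (p : int * int) : int * int := (p.2, p.1).
Definition mirror (p : int * int) : int * int := (- p.1, p.2).

Lemma pairE (p q : int * int) : (p == q) = (p.1 == q.1) && (p.2 == q.2).
Proof. by []. Qed.

Section DrawingMove.
Variables (V : eqType) (par : V -> V).

Lemma drawing_shift d B E s phi :
  drawing par E s phi -> drawn_in par B E s phi ->
  [/\ drawing par E s (shift d \o phi),
      drawn_in par [pred q | B (q.1 - d.1, q.2 - d.2)] E s (shift d \o phi)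
    & wire_length par E s (shift d \o phi) = wire_length par E s phi].
Proof.
move=> D Hs; pose h (q : int * int) : int * int := (q.1 - d.1, q.2 - d.2).
have gK : cancel (shift d) h by case=> x y; rewrite /h /=; congr pair; lia.
have hK : cancel h (shift d) by case=> x y; rewrite /shift /=; congr pair; lia.
have bg p q r : box (shift d p) (shift d q) (shift d r) = box p q r.
  by rewrite /box /between /=; lia.
have ag p q : aligned (shift d p) (shift d q) = aligned p q.
  by rewrite /aligned /=; lia.
have dg p q : dist1 (shift d p) (shift d q) = dist1 p q.
  by rewrite /dist1 /=; lia.
split; first exact: (drawing_isometry gK hK).
  exact: (drawn_in_isometry gK hK bg).
exact: wire_length_isometry.
Qed.

Lemma drawing_transpose B E s phi :
  drawing par E s phi -> drawn_in par B E s phi ->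
  [/\ drawing par E s (transpose \o phi),
      drawn_in par [pred q | B (q.2, q.1)] E s (transpose \o phi)
    & wire_length par E s (transpose \o phi) = wire_length par E s phi].
Proof.
move=> D Hs.
have gK : cancel transpose transpose by case.
have bg p q r : box (transpose p) (transpose q) (transpose r) = box p q r.
  by rewrite /box /between /=; lia.
have ag p q : aligned (transpose p) (transpose q) = aligned p q.
  by rewrite /aligned /=; lia.
have dg p q : dist1 (transpose p) (transpose q) = dist1 p q.
  by rewrite /dist1 /=; lia.
split; first exact: (drawing_isometry gK gK).
  exact: (drawn_in_isometry gK gK bg).
exact: wire_length_isometry.
Qed.

Lemma drawing_mirror B E s phi :
  drawing par E s phi -> drawn_in par B E s phi ->
  [/\ drawing par E s (mirror \o phi),
      drawn_in par [pred q | B (- q.1, q.2)] E s (mirror \o phi)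
    & wire_length par E s (mirror \o phi) = wire_length par E s phi].
Proof.
move=> D Hs.
have gK : cancel mirror mirror by case=> x y; rewrite /mirror /= opprK.
have bg p q r : box (mirror p) (mirror q) (mirror r) = box p q r.
  by rewrite /box /between /=; lia.
have ag p q : aligned (mirror p) (mirror q) = aligned p q.
  by rewrite /aligned /=; lia.
have dg p q : dist1 (mirror p) (mirror q) = dist1 p q.
  by rewrite /dist1 /=; lia.
split; first exact: (drawing_isometry gK gK).
  exact: (drawn_in_isometry gK gK bg).
exact: wire_length_isometry.
Qed.

End DrawingMove.

(** * Gluing rooted trees that are drawn in boxes *)

Section Attach.
Variables (V : eqType) (par : V -> V).

(** The tree [s] with root [x] becomes a branch at the root [w] of [r]. The disjoint regions [B] and
    [C] separate the two drawings, and the new wire touches each region only at its end there. *)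
Lemma drawing_attach (B C : pred (int * int)) r s w x phi1 phi2 :
  drawing par (predC1 w) r phi1 -> drawing par (predC1 x) s phi2 ->
  drawn_in par B (predC1 w) r phi1 -> drawn_in par C (predC1 x) s phi2 ->
  uniq (r ++ s) -> w \in r -> x \in s -> par x = w ->
  (forall q, B q -> C q -> false) ->
  aligned (phi1 w) (phi2 x) -> phi1 w != phi2 x ->
  (forall q, box (phi1 w) (phi2 x) q -> B q -> q = phi1 w) ->
  (forall q, box (phi1 w) (phi2 x) q -> C q -> q = phi2 x) ->
  exists phi, [/\ drawing par (predC1 w) (r ++ s) phi,
    {in r, phi =1 phi1},
    drawn_in par [pred q | [|| B q, C q | box (phi1 w) (phi2 x) q]]
      (predC1 w) (r ++ s) phi &
    wire_length par (predC1 w) (r ++ s) phi =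
      (wire_length par (predC1 w) r phi1 + wire_length par (predC1 x) s phi2
       + dist1 (phi1 w) (phi2 x))%N].
Proof.
move=> D1 D2 dB dC us wr xs px BC al nz wB wC.
pose phi u := if u \in s then phi2 u else phi1 u.
(* Both roots are still unlinked in [E0]; the edge from [x] to [w] is added afterwards by
   [drawing_link]. *)
pose E0 : pred V := fun v => (v != w) && (v != x).
have rs v : v \in r -> v \notin s.
  move=> vr; apply/negP => vs; move: us; rewrite cat_uniq => /and3P[_ /hasPn H _].
  by have := H v vs; rewrite /= vr.
have p1 : {in r, phi1 =1 phi} by move=> v /rs; rewrite /phi => /negbTE->.
have p2 : {in s, phi2 =1 phi} by move=> v; rewrite /phi => ->.
have E1 : {in r, predC1 w =1 E0}.
  move=> v vr; rewrite /E0 /=; case: (eqVneq v x) => [vx|]; last by rewrite andbT.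
  by have := rs v vr; rewrite vx xs.
have E2 : {in s, predC1 x =1 E0}.
  move=> v vs; rewrite /E0 /=; case: (eqVneq v w) => [vw|] //.
  by have := rs w wr; rewrite -vw vs.
have xr : x \notin r by apply: contraL xs; apply: rs.
have xw : x != w by apply: contraNneq xr => ->.
have D1' := eq_drawing (fun=> erefl) E1 p1 D1.
have D2' := eq_drawing (fun=> erefl) E2 p2 D2.
have dB' := eq_drawn_in (fun=> erefl) E1 p1 D1 dB.
have dC' := eq_drawn_in (fun=> erefl) E2 p2 D2 dC.
have L1 := eq_wire_length (perm_refl _) E1 p1 D1.
have L2 := eq_wire_length (perm_refl _) E2 p2 D2.
have D := drawing_cat_box D1' D2' dB' dC' BC.
have pw : phi w = phi1 w by rewrite p1.
have pp : phi x = phi2 x by rewrite p2.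
have nE : ~~ E0 x by rewrite /E0 eqxx andbF.
have xrs : x \in r ++ s by rewrite mem_cat xs orbT.
have EE : {in r ++ s, predU1 x E0 =1 predC1 w}.
  by move=> v _; rewrite /E0 /=; case: (eqVneq v x) => [->|_]; rewrite ?xw ?andbT.
have DD : drawing par (predU1 x E0) (r ++ s) phi.
  apply: drawing_link => //; rewrite px ?pw ?pp //.
    by rewrite mem_cat wr.
  move=> v q; rewrite mem_cat => /orP[vr|vs] vx Wq bq.
    exact/wB/(dB' v).
  (* A wire of [s] that meets the new one does so at [phi2 x], hence it is the wire of [x]
     itself. *)
  have qx := wC _ bq (dC' v q vs Wq).
  case/eqP: vx; apply: (drawing_disjoint D2' (q := q)) => //.
  by rewrite qx -pp; apply: (wire_end D2').
exists phi; split=> //.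
- exact: eq_drawing EE _ DD.
- by move=> v /p1.
- apply: (eq_drawn_in _ EE _ DD) => // v q; rewrite mem_cat => vrs.
  have [->|vx] := eqVneq v x.
    by rewrite /wire /= eqxx /= px pw pp => /andP[-> _]; rewrite !orbT.
  rewrite (eq_wire (E' := E0) (phi' := phi)) //=; last by rewrite (negbTE vx).
  by case/orP: vrs => vs Wq; [rewrite (dB' _ _ vs Wq)|rewrite (dC' _ _ vs Wq) orbT].
rewrite (eq_wire_length (perm_refl _) EE _ DD) //.
rewrite wire_length_link // wire_length_cat L1 L2 px pw pp.
by rewrite addnC.
Qed.

Definition quadrant (a b : nat) : pred (int * int) :=
  [pred q | (0 <= q.1 <= a%:Z) && (0 <= q.2 <= b%:Z)].

(** The numbers are the total wire length, the width and the height. The root sits at a corner of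
    the box, where a horizontal or a vertical wire can reach it from outside. *)
Definition layout (w : V) s (n a b : nat) : Prop :=
  exists phi, [/\ drawing par (predC1 w) s phi, phi w = (0, 0), w \in s,
    drawn_in par (quadrant a b) (predC1 w) s phi &
    wire_length par (predC1 w) s phi = n].

Lemma layout1 w : layout w [:: w] 0 0 0.
Proof.
exists (fun=> (0, 0)); split; rewrite ?inE//.
- by apply: drawing1; rewrite /= eqxx.
- move=> v q; rewrite inE => /eqP->; rewrite /wire /= eqxx /= => /eqP->.
  by [].
by rewrite wire_length1 //= eqxx.
Qed.

Lemma drawn_inW (B C : pred (int * int)) E s phi : {subset B <= C} ->
  drawn_in par B E s phi -> drawn_in par C E s phi.
Proof. by move=> BC H v q sv wq; apply: BC; apply: H sv wq. Qed.

(** The box of the subtree moves one step to the right, which frees a column for [w] and costs one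
    unit of wire. *)
Lemma layout_chain w x s n a b : par x = w -> uniq (w :: s) ->
  layout x s n a b -> layout w (w :: s) n.+1 a.+1 b.
Proof.
move=> px us [phi2 [D2 p2 xs I2 L2]].
have [phi1 [D1 p1 wr I1 L1]] := layout1 w.
have [D2' I2' L2'] := drawing_shift (1, 0) D2 I2.
have [|||||phi [D p I L]] :=
  drawing_attach D1 D2' I1 I2' (us : uniq ([:: w] ++ s)) wr xs px.
- by move=> q; rewrite /quadrant /=; lia.
- by rewrite /= p1 p2.
- by rewrite /= p1 p2.
- by move=> [q1 q2]; rewrite /quadrant /= p1 p2
    /box /between /shift /transpose /= => ? ?;
  congr pair; lia.
- by move=> [q1 q2]; rewrite /quadrant /= p1 p2
    /box /between /shift /transpose /= => ? ?;
  congr pair; lia.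
exists phi; split=> //.
- by rewrite p.
- by rewrite inE eqxx.
- apply: drawn_inW I => q; rewrite -!topredE /quadrant /= p1 p2 /box /between /=; lia.
by rewrite L L1 L2' L2 /= p1 p2 /dist1 /=; lia.
Qed.

(* The first subtree is transposed above w, the second lies to its right. *)
Lemma layout_transposed w x y s t n1 a1 b1 n2 a2 b2 :
  par x = w -> par y = w -> uniq (w :: s ++ t) ->
  layout x s n1 a1 b1 -> layout y t n2 a2 b2 ->
  layout w (w :: s ++ t) (n1 + n2 + b1 + 2) (b1 + a2).+1 (maxn a1.+1 b2).
Proof.
move=> px py us [phi1 [D1 p1 xs I1 L1]] [phi2 [D2 p2 yt I2 L2]].
have [phi0 [D0 p0 wr I0 L0]] := layout1 w.
have [D1' I1' L1'] := drawing_transpose D1 I1.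
have [D1'' I1'' L1''] := drawing_shift (0, 1) D1' I1'.
have U : uniq ([:: w] ++ s) by move: us; rewrite -cat_cons cat_uniq => /and3P[].
have [|||||phi [D p I L]] := drawing_attach D0 D1'' I0 I1'' U wr xs px.
- by move=> q; rewrite /quadrant /=; lia.
- by rewrite /= p1 p0.
- by rewrite /= p1 p0.
- by move=> [q1 q2]; rewrite /quadrant /= p0 ?p1
    /box /between /shift /transpose /= => ? ?;
  congr pair; lia.
- by move=> [q1 q2]; rewrite /quadrant /= p0 ?p1
    /box /between /shift /transpose /= => ? ?;
  congr pair; lia.
(* After transposition the first box has width [b1], so column [b1 + 1] is the first free one; the
   wire to [y] runs along row 0, below the first box. *)
have [D2' I2' L2'] := drawing_shift (b1.+1%:Z, 0) D2 I2.
have wr' : w \in [:: w] ++ s by rewrite mem_cat wr.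
have pw : phi w = (0, 0) by rewrite p.
have U' : uniq (([:: w] ++ s) ++ t) by rewrite -catA.
have [|||||phi' [D' p' I' L'']] := drawing_attach D D2' I I2' U' wr' yt py.
- by move=> q; rewrite /quadrant /= p0 p1 /box /between /=; lia.
- by rewrite /= pw p2.
- by rewrite /= pw p2 pairE /=; lia.
- by move=> [q1 q2]; rewrite /quadrant /= pw ?p0 ?p1 ?p2
    /box /between /shift /transpose /= => ? ?;
  congr pair; lia.
- by move=> [q1 q2]; rewrite /quadrant /= pw ?p0 ?p1 ?p2
    /box /between /shift /transpose /= => ? ?;
  congr pair; lia.
exists phi'; split=> //.
- by rewrite p'.
- by rewrite inE eqxx.
- apply: drawn_inW I' => q; rewrite -!topredE /quadrant /= pw p0 p1 p2 /box /between /=; lia.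
by rewrite /= in L''; rewrite L'' L L0 L1'' L1' L1 L2' L2 /= pw p0 p1 p2 /dist1 /=; lia.
Qed.

(** The first box starts one step to the right of [w] and occupies the rows up to [b1]. The wire to
    [y] climbs in the free column 0 to row [b1 + 1], where the second box begins, so the two new
    wires have length [1 + (b1 + 1)]. *)
Lemma layout_stacked w x y s t n1 a1 b1 n2 a2 b2 :
  par x = w -> par y = w -> uniq (w :: s ++ t) ->
  layout x s n1 a1 b1 -> layout y t n2 a2 b2 ->
  layout w (w :: s ++ t) (n1 + n2 + b1 + 2) (maxn a1.+1 a2) (b1 + b2).+1.
Proof.
move=> px py us [phi1 [D1 p1 xs I1 L1]] [phi2 [D2 p2 yt I2 L2]].
have [phi0 [D0 p0 wr I0 L0]] := layout1 w.
have [D1'' I1'' L1''] := drawing_shift (1, 0) D1 I1.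
have U : uniq ([:: w] ++ s) by move: us; rewrite -cat_cons cat_uniq => /and3P[].
have [|||||phi [D p I L]] := drawing_attach D0 D1'' I0 I1'' U wr xs px.
- by move=> q; rewrite /quadrant /=; lia.
- by rewrite /= p1 p0.
- by rewrite /= p1 p0.
- by move=> [q1 q2]; rewrite /quadrant /= p0 ?p1
    /box /between /shift /transpose /= => ? ?;
  congr pair; lia.
- by move=> [q1 q2]; rewrite /quadrant /= p0 ?p1
    /box /between /shift /transpose /= => ? ?;
  congr pair; lia.
have [D2' I2' L2'] := drawing_shift (0, b1.+1%:Z) D2 I2.
have wr' : w \in [:: w] ++ s by rewrite mem_cat wr.
have pw : phi w = (0, 0) by rewrite p.
have U' : uniq (([:: w] ++ s) ++ t) by rewrite -catA.
have [|||||phi' [D' p' I' L'']] := drawing_attach D D2' I I2' U' wr' yt py.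
- by move=> q; rewrite /quadrant /= p0 p1 /box /between /=; lia.
- by rewrite /= pw p2.
- by rewrite /= pw p2 pairE /=; lia.
- by move=> [q1 q2]; rewrite /quadrant /= pw ?p0 ?p1 ?p2
    /box /between /shift /transpose /= => ? ?;
  congr pair; lia.
- by move=> [q1 q2]; rewrite /quadrant /= pw ?p0 ?p1 ?p2
    /box /between /shift /transpose /= => ? ?;
  congr pair; lia.
exists phi'; split=> //.
- by rewrite p'.
- by rewrite inE eqxx.
- apply: drawn_inW I' => q; rewrite -!topredE /quadrant /= pw p0 p1 p2 /box /between /=; lia.
by rewrite /= in L''; rewrite L'' L L0 L1'' L1 L2' L2 /= pw p0 p1 p2 /dist1 /=; lia.
Qed.

(** The rows are unrestricted because components are separated by columns only. *)
Definition strip (N : nat) : pred (int * int) := [pred q | 0 <= q.1 <= N%:Z].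

(** The tree of [w] fills a quadrant to the right, so the reflected tree of [x] fits into the
    columns from -1 leftwards. *)
Lemma layout_mirrored w x s t n1 a1 b1 n2 a2 b2 :
  par x = w -> uniq (s ++ t) ->
  layout w s n1 a1 b1 -> layout x t n2 a2 b2 ->
  exists phi, [/\ drawing par (predC1 w) (s ++ t) phi,
    drawn_in par (strip (a1 + a2.+1)) (predC1 w) (s ++ t) phi &
    wire_length par (predC1 w) (s ++ t) phi = (n1 + n2).+1].
Proof.
move=> px us [phi1 [D1 p1 w1 I1 L1]] [phi2 [D2 p2 w2 I2 L2]].
have [D2' I2' L2'] := drawing_mirror D2 I2.
have [D3 I3 L3] := drawing_shift (-1, 0) D2' I2'.
have [|||||phi [D p I L]] := drawing_attach D1 D3 I1 I3 us w1 w2 px.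
- by move=> q; rewrite /quadrant /=; lia.
- by rewrite /= p1 p2.
- by rewrite /= p1 p2.
- by move=> [q1 q2]; rewrite /quadrant /= p1 p2
    /box /between /shift /mirror /= => ? ?;
  congr pair; lia.
- by move=> [q1 q2]; rewrite /quadrant /= p1 p2
    /box /between /shift /mirror /= => ? ?;
  congr pair; lia.
(* The leftmost column in use is at least [-(a2 + 1)]; the translation brings it into the strip. *)
have [D' I' L'] := drawing_shift (a2.+1%:Z, 0) D I.
exists (shift (a2.+1%:Z, 0) \o phi); split=> //.
  apply: drawn_inW I' => q.
  by rewrite -!topredE /quadrant /strip /= p1 p2 /box /between /shift /mirror /=; lia.
by rewrite L' L L1 L3 L2' L2 /= p1 p2 /dist1 /=; lia.
Qed.

End Attach.

(** * Layouts of linear size for trees with at most two children per vertex *)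

Section LinearLayout.
Variables (V : eqType) (par : V -> V).

Lemma layout_perm w s s' n a b : perm_eq s s' ->
  layout par w s n a b -> layout par w s' n a b.
Proof.
move=> ss [phi [D p ws I L]]; have ms := perm_mem ss.
exists phi; split=> //; rewrite -?ms//.
- exact: eq_drawing ms _ _ D.
- exact: eq_drawn_in ms _ _ D I.
by rewrite (eq_wire_length ss _ _ D).
Qed.

(** The weighted sum [n + a + 2 b] is a potential: each root that becomes a child raises the
    allowance by 3, so a chain step may spend 3 and a fork 6. *)
Definition linear_layout w s : Prop := exists n a b,
  layout par w s n a b /\ (n + a + b.*2 <= 3 * (size s).-1)%N.

Lemma layout_size w s n a b : layout par w s n a b -> (0 < size s)%N.
Proof. by case=> phi [_ _ ws _ _]; rewrite lt0n size_eq0; apply: contraTneq ws => ->. Qed.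

Lemma linear_layout1 w : linear_layout w [:: w].
Proof. by exists 0%N, 0%N, 0%N; split; first exact: layout1. Qed.

Lemma linear_layout_chain w x s : par x = w -> uniq (w :: s) ->
  linear_layout x s -> linear_layout w (w :: s).
Proof.
move=> px us [n [a [b [L H]]]]; have := layout_size L => H0.
exists n.+1, a.+1, b; split; first exact: layout_chain px us L.
by rewrite /=; lia.
Qed.

(* Depending on the shapes of the two boxes, either one of the subtrees can be
   turned around, or the subtrees are stacked, the wider one at the bottom. *)
Lemma linear_layout_fork w x y s t : par x = w -> par y = w ->
  uniq (w :: s ++ t) -> linear_layout x s -> linear_layout y t ->
  linear_layout w (w :: s ++ t).
Proof.
move=> px py us [n1 [a1 [b1 [L1 H1]]]] [n2 [a2 [b2 [L2 H2]]]].
have s0 := layout_size L1; have t0 := layout_size L2.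
have pe : perm_eq (w :: t ++ s) (w :: s ++ t) by rewrite perm_cons perm_catC.
have us' : uniq (w :: t ++ s) by rewrite (perm_uniq pe).
(* When [a1 <= 2 b2], twice the new height is at most [a1 + 2 b2 + 2], and the potential grows by at
   most 5. *)
have [h1|h1] := leqP a1 b2.*2.
  exists (n1 + n2 + b1 + 2)%N, (b1 + a2).+1, (maxn a1.+1 b2).
  split; first exact: layout_transposed px py us L1 L2.
  by rewrite /= size_cat; lia.
have [h2|h2] := leqP a2 b1.*2.
  exists (n2 + n1 + b2 + 2)%N, (b2 + a1).+1, (maxn a2.+1 b1).
  split; first exact: layout_perm pe (layout_transposed py px us' L2 L1).
  by rewrite /= size_cat; lia.
(* Now [a1 > 2 b2] and [a2 > 2 b1]. Stacking drops the smaller width, and this pays for the vertical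
   wire along the bottom box, whose height is less than half of that width. *)
have [h|h] := leqP a1 a2.
  exists (n2 + n1 + b2 + 2)%N, (maxn a2.+1 a1), (b2 + b1).+1.
  split; first exact: layout_perm pe (layout_stacked py px us' L2 L1).
  by rewrite /= size_cat; lia.
exists (n1 + n2 + b1 + 2)%N, (maxn a1.+1 a2), (b1 + b2).+1.
split; first exact: layout_stacked px py us L1 L2.
by rewrite /= size_cat; lia.
Qed.

End LinearLayout.

(** * Drawing the finite subforests of the 3-regular tree *)

Lemma uniq_flatten_map (T U : eqType) (f : T -> seq U) s : uniq s ->
  (forall a, uniq (f a)) ->
  (forall a b v, a \in s -> b \in s -> v \in f a -> v \in f b -> a = b) ->
  uniq (flatten (map f s)).
Proof.
elim: s => //= a s IH /andP[as_ us] uf H.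
rewrite cat_uniq uf IH//= ?andbT; last first.
  by move=> b c v bs cs; apply: H; rewrite inE ?bs ?cs orbT.
apply/hasPn => v /flatten_mapP[b bs vb]; apply: contra as_ => va.
by rewrite (H a b v) // inE ?eqxx ?bs ?orbT.
Qed.

Section Forest.
Variables (S : seq (seq 'I_3)) (E : pred (seq 'I_3)).
Hypotheses (uniqS : uniq S) (redS : forall v, v \in S -> reduced v).
Hypotheses (E_S : forall v, E v -> v \in S) (E_nil : ~~ E [::]).
Hypothesis E_behead : forall v, E v -> behead v \in S.

(** The vertex [v] lies in the subtree of [w]: the path from [v] up to [w], which deletes leading
    letters, uses only edges that are present in the forest. *)
Fixpoint below w v : bool :=
  (v == w) || (if v is _ :: v' then E v && below w v' else false).

Lemma belowE w v : below w v = (v == w) || E v && below w (behead v).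
Proof. by case: v => [|a v] /=; rewrite ?(negbTE E_nil). Qed.

Lemma below_refl w : below w w.
Proof. by rewrite belowE eqxx. Qed.

Lemma below_drop w v : below w v -> w = drop (size v - size w) v.
Proof.
suff : below w v -> exists u, v = u ++ w.
  by move=> H /H [u ->]; rewrite size_cat addnK drop_size_cat.
elim: v => [|a v IH] /=; first by rewrite orbF => /eqP<-; exists [::].
case/orP=> [/eqP<-|/andP[_ /IH[u ->]]]; first by exists [::].
by exists (a :: u).
Qed.

(** The recursive definition removes the edge of the path at [v]; here the edge at [w] is split off
    instead, as the decomposition into principal subtrees requires. *)
Lemma below_kids w v :
  below w v = (v == w) || [exists a, E (a :: w) && below (a :: w) v].
Proof.
elim: v => [|c v IH].
  rewrite belowE (negbTE E_nil) /=; congr orb; apply/esym/existsP => -[a].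
  by rewrite andbF.
rewrite belowE /= IH; congr orb; apply/andP/existsP.
- case=> Ecv /orP[/eqP vw|/existsP[a /andP[Ea ba]]].
    by exists c; rewrite -vw Ecv eqxx.
  by exists a; rewrite Ea Ecv ba orbT.
- case=> a /andP[Ea /orP[/eqP[ca vw]|/andP[Ecv ba]]].
    by rewrite ca vw Ea eqxx.
  split=> //; apply/orP; right; apply/existsP; exists a; by rewrite Ea.
Qed.

Lemma below_sibling a b w v : below (a :: w) v -> below (b :: w) v -> a = b.
Proof. by move=> /below_drop + /below_drop; rewrite /= => <- [->]. Qed.

Definition descendants w := [seq v <- S | below w v].
Definition kids w := [seq a <- enum 'I_3 | E (a :: w)].

Lemma uniq_descendants w : uniq (descendants w).
Proof. exact: filter_uniq. Qed.

Lemma mem_kids a w : (a \in kids w) = E (a :: w).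
Proof. by rewrite mem_filter mem_enum andbT. Qed.

Lemma perm_descendants w : w \in S ->
  perm_eq (w :: flatten [seq descendants (a :: w) | a <- kids w]) (descendants w).
Proof.
move=> wS; apply: uniq_perm; last 1 first.
- move=> v; rewrite inE mem_filter below_kids.
  case: eqVneq => [->|_] //=; apply/flatten_mapP/andP.
    case=> a; rewrite mem_kids mem_filter => Ea /andP[ba vS].
    by split=> //; apply/existsP; exists a; rewrite Ea.
  case=> /existsP[a /andP[Ea ba]] vS; exists a; first by rewrite mem_kids.
  by rewrite mem_filter ba.
- rewrite cons_uniq; apply/andP; split.
    apply/negP => /flatten_mapP[a _]; rewrite mem_filter => /andP[/below_drop].
    by move=> /(congr1 size); rewrite size_drop /=; lia.
  apply: uniq_flatten_map => [|a|a b v _ _].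
  + by rewrite filter_uniq ?enum_uniq.
  + exact: uniq_descendants.
  + rewrite !mem_filter => /andP[ba _] /andP[bb _].
    exact: below_sibling ba bb.
exact: uniq_descendants.
Qed.

(** In a reduced word the letter put in front differs from the head of [w], which leaves two
    choices. Only the empty word can have three children. *)
Lemma size_kids w : w != [::] -> (size (kids w) <= 2)%N.
Proof.
case: w => // h w _; have s2 : size (enum (predC1 h)) = 2%N.
  by rewrite -cardE cardC1 card_ord.
apply: leq_trans (eq_leq s2); apply: uniq_leq_size; first by rewrite filter_uniq ?enum_uniq.
by move=> a; rewrite mem_kids mem_enum => /E_S/redS /= /andP[].
Qed.

Lemma linear_layout_kids w : w \in S -> (size (kids w) <= 2)%N ->
  (forall a, E (a :: w) ->
     linear_layout (@behead 'I_3) (a :: w) (descendants (a :: w))) ->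
  linear_layout (@behead 'I_3) w (descendants w).
Proof.
move=> wS + H; have HK a : a \in kids w ->
  linear_layout (@behead 'I_3) (a :: w) (descendants (a :: w)).
  by rewrite mem_kids => /H.
have pK := perm_descendants wS; have := perm_uniq pK.
rewrite uniq_descendants.
suff : uniq (w :: flatten [seq descendants (a :: w) | a <- kids w]) ->
    (size (kids w) <= 2)%N ->
    linear_layout (@behead 'I_3) w (w :: flatten [seq descendants (a :: w) | a <- kids w]).
  move=> + u s => /(_ u s) [n [a [b [L P]]]]; exists n, a, b.
  by rewrite -(perm_size pK); split=> //; apply: layout_perm L.
move: HK; case: (kids w) => [|a [|b []]] //= HK us _.
- exact: linear_layout1.
- rewrite cats0 in us *; apply: (@linear_layout_chain _ _ _ (a :: w)) => //.
  by apply: HK; rewrite inE.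
- rewrite cats0 in us *; apply: (@linear_layout_fork _ _ _ (a :: w) (b :: w)) => //.
    by apply: HK; rewrite inE eqxx.
  by apply: HK; rewrite !inE eqxx orbT.
Qed.

Lemma linear_layout_descendants w : w \in S -> w != [::] ->
  linear_layout (@behead 'I_3) w (descendants w).
Proof.
move=> wS w0.
(* The induction is on a bound [m] for the depth of the forest below [w]; any finite bound will
   do. *)
have [m] : exists m, forall v, v \in S -> (size v <= m + size w)%N.
  exists (\sum_(v <- S) size v)%N => v vS.
  by rewrite (perm_big _ (perm_to_rem vS)) big_cons -addnA leq_addr.
elim: m w wS w0 => [|m IH] w wS w0 Hm.
  apply: linear_layout_kids (size_kids w0) _ => // a /E_S /Hm /=; lia.
apply: linear_layout_kids (size_kids w0) _ => // a Ea; apply: IH => //.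
  exact: E_S.
by move=> v vS; rewrite /= addnS -addSn; apply: Hm.
Qed.

Lemma linear_drawing_layout w s : linear_layout (@behead 'I_3) w s ->
  exists phi N, [/\ drawing (@behead 'I_3) (predC1 w) s phi,
    drawn_in (@behead 'I_3) (strip N) (predC1 w) s phi &
    (wire_length (@behead 'I_3) (predC1 w) s phi <= 3 * size s)%N].
Proof.
case=> n [a [b [[phi [D p ws I L]] H]]]; exists phi, a; split=> //; last by lia.
by apply: drawn_inW I => q; rewrite -!topredE /strip /quadrant /=; lia.
Qed.

(** If the empty word has three children, two of the subtrees form a fork to the right and the third
    one is mirrored to the left. *)
Lemma linear_drawing_descendants w : w \in S ->
  exists phi N, [/\ drawing (@behead 'I_3) (predC1 w) (descendants w) phi,
    drawn_in (@behead 'I_3) (strip N) (predC1 w) (descendants w) phi &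
    (wire_length (@behead 'I_3) (predC1 w) (descendants w) phi <=
      3 * size (descendants w))%N].
Proof.
have [->|w0] := eqVneq w [::]; last first.
  by move=> wS; apply/linear_drawing_layout/linear_layout_descendants.
move=> wS; have H a : E [:: a] ->
    linear_layout (@behead 'I_3) [:: a] (descendants [:: a]).
  by move=> Ea; apply: linear_layout_descendants => //; apply: E_S.
have [s2|s2] := leqP (size (kids [::])) 2.
  exact/linear_drawing_layout/linear_layout_kids.
have s3 : size (kids [::]) = 3%N.
  apply/eqP; rewrite eqn_leq s2 andbT -[X in (_ <= X)%N](size_enum_ord 3).
  exact: size_subseq (filter_subseq _ _).
have HK a : a \in kids [::] -> linear_layout (@behead 'I_3) [:: a] (descendants [:: a]).
  by rewrite mem_kids => /H.
have pK := perm_descendants wS.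
have := perm_uniq pK; rewrite uniq_descendants.
case: (kids [::]) s3 HK pK => [|a [|b [|c []]]] //= _ HK.
rewrite cats0; set A := descendants [:: a]; set B := descendants [:: b].
set C := descendants [:: c]; set r := [::] => pK us.
have pe : perm_eq ((r :: A ++ B) ++ C) (descendants r).
  by rewrite cat_cons -catA.
have us' : uniq ((r :: A ++ B) ++ C) by rewrite cat_cons -catA.
have usAB : uniq (r :: A ++ B) by move: us'; rewrite cat_uniq => /and3P[].
have LA := HK a (mem_head _ _).
have LB : linear_layout (@behead 'I_3) [:: b] B by apply: HK; rewrite !inE eqxx orbT.
have LC : linear_layout (@behead 'I_3) [:: c] C by apply: HK; rewrite !inE eqxx !orbT.
have [n1 [a1 [b1 [L1 H1]]]] :=
  linear_layout_fork (erefl : behead [:: a] = r) (erefl : behead [:: b] = r)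
    usAB LA LB.
have [n2 [a2 [b2 [L2 H2]]]] := LC.
have C0 := layout_size L2.
have [phi [D I L]] := layout_mirrored (erefl : behead [:: c] = r) us' L1 L2.
exists phi, (a1 + a2.+1)%N; split.
- by apply: eq_drawing (perm_mem pe) _ _ D.
- exact: eq_drawn_in (perm_mem pe) _ _ D I.
rewrite (eq_wire_length pe _ _ D) // L -(perm_size pe) size_cat.
by move: H1 H2 C0; clear; rewrite /=; lia.
Qed.

(** The climb from [v] towards shorter words is deterministic and stops at the first vertex outside
    [E]. *)
Lemma root_unique r r' v : ~~ E r -> ~~ E r' -> below r v -> below r' v -> r = r'.
Proof.
move=> nr nr'; elim: v => [|a v IH].
  by rewrite /= !orbF => /eqP<- /eqP<-.
rewrite /=.
case: eqP => [vr|_]; case: eqP => [vr'|_] //=.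
- by rewrite -vr -vr'.
- by rewrite vr (negbTE nr).
- by rewrite vr' (negbTE nr').
by move=> /andP[_ b] /andP[_ b']; apply: IH.
Qed.

Lemma root_exists v : v \in S -> exists2 r, r \in [seq r <- S | ~~ E r] & below r v.
Proof.
elim: v => [|a v IH] vS.
  by exists [::]; rewrite ?mem_filter ?E_nil// below_refl.
case Ev: (E (a :: v)); last first.
  by exists (a :: v); rewrite ?mem_filter ?Ev// below_refl.
have [r rS br] := IH (E_behead Ev); exists r => //.
by rewrite belowE Ev /= br orbT.
Qed.

Lemma linear_drawing_components rs : uniq rs ->
  {subset rs <= [seq r <- S | ~~ E r]} ->
  let s := flatten [seq descendants r | r <- rs] in
  exists phi N, [/\ drawing (@behead 'I_3) E s phi,
    drawn_in (@behead 'I_3) (strip N) E s phi &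
    (wire_length (@behead 'I_3) E s phi <= 3 * size s)%N].
Proof.
elim: rs => [_ _|r rs IH /= /andP[rrs urs] sub] /=.
  by exists (fun=> (0, 0)), 0%N; split=> //; rewrite /wire_length big_nil.
have [phi2 [N2 [D2 I2 L2]]] := IH urs (fun v vr => sub v (mem_behead (s := r :: rs) vr)).
have : r \in [seq r <- S | ~~ E r] by rewrite sub ?mem_head.
rewrite mem_filter => /andP[nEr rS].
have [phi1 [N1 [D1 I1 L1]]] := linear_drawing_descendants rS.
set s := descendants r in D1 I1 L1 *; set t := flatten _ in D2 I2 L2 *.
(* The first component occupies columns 0 to [N1]; the remaining ones are moved past them. *)
have [D3 I3 L3] := drawing_shift (N1.+1%:Z, 0) D2 I2.
have EE : {in s, predC1 r =1 E}.
  move=> v; rewrite mem_filter belowE /=; case: eqVneq => [->|_] //=.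
    by rewrite (negbTE nEr).
  by move=> /andP[/andP[->]].
pose phi v := if v \in s then phi1 v else (shift (N1.+1%:Z, 0) \o phi2) v.
have st v : v \in t -> v \notin s.
  move=> /flatten_mapP[r' r'rs]; rewrite !mem_filter => /andP[br' _].
  apply/negP => /andP[br _]; move: rrs; rewrite (root_unique nEr _ br br') ?r'rs//.
  have : r' \in [seq r <- S | ~~ E r] by rewrite sub // inE r'rs orbT.
  by rewrite mem_filter => /andP[].
have e1 : {in s, phi1 =1 phi} by move=> v vs; rewrite /phi vs.
have e2 : {in t, shift (N1.+1%:Z, 0) \o phi2 =1 phi}.
  by move=> v /st; rewrite /phi => /negbTE->.
have D1' := eq_drawing (fun=> erefl) EE e1 D1.
have I1' := eq_drawn_in (fun=> erefl) EE e1 D1 I1.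
have D3' := eq_drawing (fun=> erefl) (fun v _ => erefl (E v)) e2 D3.
have I3' := eq_drawn_in (fun=> erefl) (fun v _ => erefl (E v)) e2 D3 I3.
exists phi, (N1 + N2).+1; split.
- by apply: drawing_cat_box D1' D3' I1' I3' _ => q; rewrite /strip /=; lia.
- move=> v q; rewrite mem_cat => /orP[vs /(I1' _ _ vs)|vt /(I3' _ _ vt)];
  by rewrite /strip /=; lia.
rewrite wire_length_cat (eq_wire_length (perm_refl _) EE e1 D1)// size_cat.
by rewrite (eq_wire_length (perm_refl _) (fun v _ => erefl (E v)) e2 D3)// L3 mulnDr leq_add.
Qed.

Lemma linear_drawing : exists phi, drawing (@behead 'I_3) E S phi /\
  (wire_length (@behead 'I_3) E S phi <= 3 * size S)%N.
Proof.
have ur : uniq [seq r <- S | ~~ E r] by exact: filter_uniq.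
have [phi [N [D _ L]]] := linear_drawing_components ur (fun v vr => vr).
set s := flatten _ in D L.
have pS : perm_eq s S.
  apply: uniq_perm => //.
    apply: uniq_flatten_map => // [a|a b v]; first exact: uniq_descendants.
    rewrite !mem_filter => /andP[na _] /andP[nb _] /andP[ba _] /andP[bb _].
    exact: root_unique ba bb.
  move=> v; apply/flatten_mapP/idP => [[r _]|vS].
    by rewrite mem_filter => /andP[].
  have [r rr b] := root_exists vS; exists r => //.
  by rewrite mem_filter b.
exists phi; split; first exact: eq_drawing (perm_mem pS) _ _ D.
by rewrite (eq_wire_length pS _ _ D) // -(perm_size pS).
Qed.

End Forest.

(** * Points and closed edges of the complex of a graph *)

Section Points.
Local Open Scope classical_set_scope.
Variables (R : realType) (V : eqType) (G : graph V).
Implicit Types (u v w : V) (x y : realization R V G).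

Lemma point_inj x y : point_coord x = point_coord y -> x = y.
Proof.
by case: x y => [x hx] [y hy] /= xy; subst y; congr Point; exact: Prop_irrelevance.
Qed.

Lemma indic1E u w : \1_[set u] w = (w == u)%:R :> R.
Proof.
rewrite indicE; congr (_%:R); congr nat_of_bool.
by apply/idP/eqP; rewrite inE.
Qed.

Lemma indic1_inj u v : \1_[set u] = \1_[set v] :> (V -> R) -> u = v.
Proof.
move=> /(congr1 (fun f => f u)); rewrite !indic1E eqxx.
by case: eqVneq => // _ /eqP; rewrite oner_eq0.
Qed.

Lemma segmentE u v (t : R) w :
  segment u v t w = (1 - t) * (w == u)%:R + t * (w == v)%:R.
Proof. by rewrite /segment !indic1E. Qed.

Lemma segment0 u v : segment u v (0 : R) = \1_[set u].
Proof. by apply/funext => w; rewrite segmentE indic1E subr0 mul1r mul0r addr0. Qed.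

Lemma segment1 u v : segment u v (1 : R) = \1_[set v].
Proof. by apply/funext => w; rewrite segmentE indic1E subrr mul1r mul0r add0r. Qed.

Lemma segmentC u v (t : R) : segment u v t = segment v u (1 - t).
Proof. by apply/funext => w; rewrite !segmentE subKr addrC. Qed.

Lemma segment_vertex u v (t : R) w : u != v ->
  segment u v t = \1_[set w] -> (t = 0 /\ w = u) \/ (t = 1 /\ w = v).
Proof.
move=> uv e; have := congr1 (fun f => f v) e; have := congr1 (fun f => f u) e.
rewrite !segmentE !indic1E !eqxx [v == u]eq_sym (negbTE uv) !mulr0 !mulr1 addr0 add0r.
have [<-|_] := eqVneq v w; first by move=> _ ->; right.
by move=> + t0; rewrite t0 subr0; case: eqVneq => [->|_ /eqP]; [left|rewrite oner_eq0].
Qed.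

Lemma clamp_id (t : R) : 0 <= t <= 1 -> clamp t = t.
Proof. by move=> /andP[t0 t1]; rewrite /clamp min_l // max_r. Qed.

Lemma clamp_continuous : continuous (@clamp R : R -> R).
Proof.
move=> t; apply: (@continuous_max _ _ (cst 0) ((@id R) \min cst 1)).
  exact: cst_continuous.
by apply: continuous_min; [exact: cvg_id|exact: cst_continuous].
Qed.

Lemma adj_neq u v : adj G u v -> u != v.
Proof. by move=> h; apply/eqP => uv; move: h; rewrite uv; exact: adj_irrefl. Qed.

(** An interior point of an edge has both ends of that edge in its support, so the edge must be {u,
    v}, in one of its two orientations. The vertices are the parameters 0 and 1. *)
Lemma closed_edgeP u v x : adj G u v ->
  closed_edge R V G [set u; v] x <->
  exists2 t : R, 0 <= t <= 1 & point_coord x = segment u v t.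
Proof.
move=> uv; have nuv := adj_neq uv.
have vtx w : point_coord x = \1_[set w] -> closed_edge R V G [set u; v] x ->
    exists2 t : R, 0 <= t <= 1 & point_coord x = segment u v t.
  move=> xw H; have : [set u; v] w by apply: H; rewrite xw indic1E eqxx oner_eq0.
  move=> [] /= wE; rewrite xw wE.
    by exists 0; rewrite ?lexx ?ler01// segment0.
  by exists 1; rewrite ?lexx ?ler01// segment1.
split=> [H|[t t01 xt] w]; last first.
  rewrite xt segmentE; have [->|wu] := eqVneq w u; first by left.
  have [->|wv] := eqVneq w v; first by right.
  by rewrite !mulr0 addr0 eqxx.
case: (point_coordP x) => [[w _ xw]|[a [b [t [ab t01 xt]]]]]; first exact: vtx xw H.
have [t0|t0] := eqVneq t 0; first by apply: (vtx a) => //; rewrite xt t0 segment0.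
have [t1|t1] := eqVneq t 1; first by apply: (vtx b) => //; rewrite xt t1 segment1.
have nab := adj_neq ab.
have /= Ha : [set u; v] a.
  by apply: H; rewrite xt segmentE eqxx (negbTE nab) mulr0 addr0 mulr1 subr_eq0 eq_sym.
have /= Hb : [set u; v] b.
  by apply: H; rewrite xt segmentE eqxx [b == a]eq_sym (negbTE nab) mulr0 add0r mulr1.
move: Ha Hb => [] /= au [] /= bv; rewrite au bv ?eqxx // in nab xt.
  by exists t.
by exists (1 - t); rewrite ?xt 1?segmentC //; lra.
Qed.

End Points.

(** * Grid lines as paths in the complex of the square lattice *)

Section Grid.
Local Open Scope classical_set_scope.
Variable R : realType.
Implicit Types (p q : int * int) (s t : R) (d : bool).

(** This is the hat function of piecewise linear interpolation: its integer translates are the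
    barycentric coordinates on the line subdivided at the integers. *)
Definition tent s : R := Num.max 0 (1 - `|s|).

(* Barycentric coordinates of a point of the plane on a grid line. *)
Definition hat (P : R * R) : int * int -> R :=
  fun q => tent (P.1 - q.1%:~R) * tent (P.2 - q.2%:~R).

Lemma tent_int (m : int) : tent m%:~R = (m == 0)%:R.
Proof.
rewrite /tent -intr_norm; case: eqVneq => [->|m0].
  by rewrite normr0 subr0 max_r.
by rewrite max_l // subr_le0 -[1]/(1%:~R) ler_int; lia.
Qed.

Lemma tent_segment (m q : int) s : 0 <= s <= 1 ->
  tent (m%:~R + s - q%:~R) = (1 - s) * (q == m)%:R + s * (q == m + 1)%:R.
Proof.
move=> /andP[s0 s1]; rewrite /tent.
have -> : m%:~R + s - q%:~R = (m - q)%:~R + s by rewrite intrB; ring.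
have [->|qm] := eqVneq q m.
  rewrite subrr add0r ger0_norm // max_r ?subr_ge0//.
  have -> : (m == m + 1) = false by lia.
  by rewrite mulr0 addr0 mulr1.
have [->|qm1] := eqVneq q (m + 1).
  have -> : (m - (m + 1)) = -1 by lia.
  rewrite mulrN1z ler0_norm ?max_r ?mulr0 ?mulr1; lra.
rewrite !mulr0 addr0 max_l // subr_le0.
have [mq|mq] : (1 <= m - q \/ m - q <= - 2) by lia.
  have : (1 : R) <= (m - q)%:~R by rewrite -[1]/(1%:~R) ler_int.
  by move=> h; rewrite ger0_norm; lra.
have : ((m - q)%:~R : R) <= - 2 by rewrite -[-2]/((-2)%:~R) ler_int.
by move=> h; rewrite ler0_norm; lra.
Qed.

(* The direction d is true for horizontal lines, false for vertical ones. *)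
Definition along d p s : R * R :=
  if d then (p.1%:~R + s, p.2%:~R) else (p.1%:~R, p.2%:~R + s).

Definition zalong d p (m : int) : int * int :=
  if d then (p.1 + m, p.2) else (p.1, p.2 + m).

(** Across the line the factor of [hat] is a Kronecker delta; along it only the translates at [m]
    and [m + 1] survive. *)
Lemma hat_along d p (m : int) t : 0 <= t <= 1 ->
  hat (along d p (m%:~R + t)) = segment (zalong d p m) (zalong d p (m + 1)) t.
Proof.
move=> t01; apply/funext => -[q1 q2]; rewrite segmentE /hat /along /zalong.
case: d => /=; rewrite !xpair_eqE addrA -intrD tent_segment // -intrB tent_int subr_eq0.
  rewrite [q2 == _]eq_sym -[p.1 + m + 1]addrA.
  by case: (p.2 == q2); rewrite ?andbT ?andbF /=; ring.
rewrite [q1 == _]eq_sym -[p.2 + m + 1]addrA.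
by case: (p.1 == q1) => /=; ring.
Qed.

Lemma Z2_adj_along d p (m : int) : adj Z2 (zalong d p m) (zalong d p (m + 1)).
Proof. by rewrite /= /Z2_adj /zalong; case: d => /=; ring. Qed.

Lemma floor_frac s : 0 <= s - (Num.floor s)%:~R <= 1.
Proof.
have := floor_itv s; rewrite intrD; lra.
Qed.

Lemma is_point_along d p s : is_point Z2 (hat (along d p s)).
Proof.
right; exists (zalong d p (Num.floor s)), (zalong d p (Num.floor s + 1)).
exists (s - (Num.floor s)%:~R); split; [exact: Z2_adj_along|exact: floor_frac|].
by rewrite -hat_along ?floor_frac // subrKC.
Qed.

Definition grid_point d p s : realization R (int * int) Z2 :=
  Point (is_point_along d p s).

Lemma grid_point_edge d p (m : int) s : m%:~R <= s <= m%:~R + 1 ->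
  grid_point d p s = edge_point (Z2_adj_along d p m) (s - m%:~R).
Proof.
move=> h; apply: point_inj => /=; rewrite clamp_id; last by lra.
by rewrite -hat_along ?subrKC//; lra.
Qed.

(** On each unit interval between integers the path is a characteristic map, so the preimage of an
    open set is known to be open on every such interval. *)
Lemma grid_point_continuous d p : continuous (grid_point d p).
Proof.
apply/continuousP => U oU; rewrite openE => s Us.
pose O (m : int) := (fun s => s - m%:~R) @^-1`
  (edge_point (R := R) (Z2_adj_along d p m) @^-1` U).
have oO m : open (O m).
  apply: open_comp => [x _|]; last exact: oU.
  by apply: continuousB; [exact: cvg_id|exact: cst_continuous].
have OU m x : m%:~R <= x <= m%:~R + 1 -> U (grid_point d p x) <-> O m x.
  by move=> h; rewrite (grid_point_edge _ _ h).
pose m := Num.floor s.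
have hs : m%:~R <= s <= m%:~R + 1 by have := floor_itv s; rewrite intrD -/m; lra.
have s1 : s < m%:~R + 1 by have := floor_itv s; rewrite intrD -/m; lra.
have Os : O m s by apply/OU.
(* At an integer two unit intervals meet, and the neighbourhood has to be good for both edges. *)
have [sm|sm] := eqVneq s m%:~R.
  have Os' : O (m - 1) s by apply/OU => //; rewrite intrB; lra.
  apply: (@filterS _ _ _ (O m `&` O (m - 1) `&` `]m%:~R - 1, m%:~R + 1[)).
    move=> x [[Ox Ox']]; rewrite /= in_itv /= => h.
    have [mx|mx] := leP m%:~R x; first by apply/(OU m) => //; lra.
    by apply/(OU (m - 1)) => //; rewrite intrB; lra.
  apply: open_nbhs_nbhs; split; last first.
    by split; [split|rewrite /= in_itv /=; lra].
  by apply: openI; [exact: openI|exact: interval_open].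
apply: (@filterS _ _ _ (O m `&` `]m%:~R, m%:~R + 1[)).
  move=> x [Ox]; rewrite /= in_itv /= => h.
  by apply/(OU m) => //; lra.
apply: open_nbhs_nbhs; split; last first.
  split=> //; rewrite /= in_itv /= s1 andbT lt_neqAle eq_sym sm /=; lra.
by apply: openI => //; exact: interval_open.
Qed.

Definition lattice_point q : realization R (int * int) Z2 :=
  @Point R _ Z2 \1_[set q] (or_introl (ex_intro2 _ _ q I erefl)).

Lemma grid_point_int d p (m : int) : grid_point d p m%:~R = lattice_point (zalong d p m).
Proof.
apply: point_inj => /=; rewrite -[m%:~R]addr0 hat_along ?lexx ?ler01//.
exact: segment0.
Qed.

Lemma grid_point_vertex d p s q : grid_point d p s = lattice_point q ->
  exists2 m : int, s = m%:~R & q = zalong d p m.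
Proof.
move=> /(congr1 (@point_coord _ _ _)) /=.
rewrite -(subrKC (Num.floor s)%:~R s) hat_along ?floor_frac //.
move=> /(segment_vertex (adj_neq (Z2_adj_along _ _ _))) [[s0 ->]|[s1 ->]].
  by exists (Num.floor s); rewrite ?s0 ?addr0.
by exists (Num.floor s + 1); rewrite ?intrD ?s1.
Qed.

Lemma closed_edge_along d p (m : int) :
  closed_edge R _ Z2 [set zalong d p m; zalong d p (m + 1)] =
  [set grid_point d p s | s in `[m%:~R, m%:~R + 1]].
Proof.
apply/seteqP; split=> x.
  move=> /(closed_edgeP _ (Z2_adj_along d p m)) [t t01 xt].
  exists (m%:~R + t); first by rewrite /= in_itv /=; lra.
  by apply: point_inj; rewrite xt /= hat_along.
case=> s; rewrite /= in_itv /= => h <-.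
apply/(closed_edgeP _ (Z2_adj_along d p m)); exists (s - m%:~R); first by lra.
by rewrite /= -hat_along ?subrKC//; lra.
Qed.

End Grid.

(** * Counting the lattice points on wires *)

Lemma aligned_zalong p q : aligned p q -> p != q ->
  exists d (n : nat), (0 < n)%N /\ (q = zalong d p n \/ p = zalong d q n).
Proof.
case: p q => p1 p2 [q1 q2]; rewrite /aligned /= xpair_eqE => al ne.
exists (p2 == q2), (dist1 (p1, p2) (q1, q2)); rewrite /dist1 /zalong /=.
split; first by lia.
case: eqP => [e|e].
  by have [h|h] := leP p1 q1; [left|right]; congr pair; lia.
by have [h|h] := leP p2 q2; [left|right]; congr pair; lia.
Qed.

Lemma box_cover p q : aligned p q -> exists L : seq (int * int),
  size L = dist1 p q /\ forall r, box p q r -> r != p -> r \in L.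
Proof.
case: p q => p1 p2 [q1 q2]; rewrite /aligned /box /between /= => al.
(* The points are listed by their distance from [p], starting at 1 since [p] is left out. *)
exists [seq (if p1 == q1 then (p1, if p2 <= q2 then p2 + i.+1%:Z else p2 - i.+1%:Z)
       else (if p1 <= q1 then p1 + i.+1%:Z else p1 - i.+1%:Z, p2)) |
    i <- iota 0 (dist1 (p1, p2) (q1, q2))].
rewrite size_map size_iota; split=> // -[r1 r2]; rewrite xpair_eqE /= => b ne.
apply/mapP; exists (`|r1 - p1| + `|r2 - p2|).-1%N.
  by rewrite mem_iota /dist1 /=; lia.
by case: eqP => e; case: ifP => h; congr pair; lia.
Qed.

Section DrawingCover.
Variables (V : eqType) (par : V -> V) (E : pred V) (phi : V -> int * int).

(** The half-open wire of a child has as many points as its length, and that of a root is a single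
    point, paid for by [size s]. *)
Lemma wires_cover s : (forall v, v \in s -> E v -> aligned (phi (par v)) (phi v)) ->
  exists Q : seq (int * int), (size Q <= size s + wire_length par E s phi)%N /\
    forall v q, v \in s -> wire par E phi v q -> q \in Q.
Proof.
elim: s => [|v s IH] al; first by exists [::].
have [|Q [sQ HQ]] := IH; first by move=> u us; apply: al; rewrite inE us orbT.
rewrite /wire_length big_cons; case: ifP => Ev.
  have [L [sL HL]] := box_cover (al _ (mem_head _ _) Ev).
  exists (L ++ Q); split; first by rewrite size_cat sL /= addSn addnCA leqW // leq_add2l.
  move=> u q; rewrite inE mem_cat => /orP[/eqP->|us wq];
    last by rewrite (HQ _ _ us wq) orbT.
  by rewrite /wire Ev => /andP[b n]; rewrite HL.
exists (phi v :: Q); split; first by rewrite /= addSn ltnS.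
move=> u q; rewrite !inE => /orP[/eqP->|us wq];
    last by rewrite (HQ _ _ us wq) orbT.
by rewrite /wire Ev => ->.
Qed.

End DrawingCover.

Lemma card_le_subsingleton T (A : set T) k : (0 < k)%N ->
  (forall a b, A a -> A b -> a = b) -> (A #<= `I_k)%card.
Proof.
move=> k0 H; have [->|/set0P[a Aa]] := eqVneq A set0; first exact: card_ge0.
apply: (@card_le_trans _ _ _ `I_1); last by rewrite card_le_II.
rewrite -(card_le_eqr (card_set1 (x := a))); apply: subset_card_le => b Ab.
exact: H.
Qed.

Lemma counting_le_size (T : choiceType) (R : realType) (A : set T) (s : seq T) n :
  (size s <= n)%N -> (forall a, A a -> a \in s) -> (counting A <= n%:R%:E :> \bar R)%E.
Proof.
move=> sn As; have fA : finite_set A.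
  by apply: (@sub_finite_set _ _ [set` s]) => //; apply/finite_seqP; exists s.
rewrite /counting asboolT // lee_fin ler_nat (leq_trans _ sn) //.
apply: uniq_leq_size => // a; rewrite in_fset_set // inE => /As.
exact.
Qed.

(** * The coarse wiring defined by a drawing *)

Section DrawingWiring.
Local Open Scope classical_set_scope.
Variables (R : realType) (V : eqType) (G : graph V) (S : seq V).
Variables (par : V -> V) (E : pred V) (phi : V -> int * int).
Hypotheses (uniqS : uniq S) (GS : vertices G = [set` S]).
Hypothesis adj_par : forall u v, adj G u v ->
  (E v /\ u = par v) \/ (E u /\ v = par u).
Hypothesis par_adj : forall v, E v -> adj G (par v) v.
Hypothesis par2 : forall v, E v -> E (par v) -> par (par v) != v.
Hypothesis D : drawing par E S phi.

(** The affine extension of [phi] to the complex, in barycentric coordinates. *)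
Definition position (x : V -> R) : R * R :=
  (\sum_(v <- S) x v * (phi v).1%:~R, \sum_(v <- S) x v * (phi v).2%:~R).

Lemma sum_indic (c : V -> R) u : u \in S -> \sum_(v <- S) (v == u)%:R * c v = c u.
Proof.
move=> uS; rewrite (bigD1_seq u) //= eqxx mul1r big1 ?addr0 // => v /negbTE->.
by rewrite mul0r.
Qed.

Lemma position_segment u v t : u \in S -> v \in S ->
  position (segment u v t) =
  ((1 - t) * (phi u).1%:~R + t * (phi v).1%:~R,
   (1 - t) * (phi u).2%:~R + t * (phi v).2%:~R).
Proof.
move=> uS vS; rewrite /position.
have H (c : V -> R) : \sum_(w <- S) segment u v t w * c w = (1 - t) * c u + t * c v.
  under eq_bigr do rewrite segmentE mulrDl -!mulrA.
  by rewrite big_split /= -!mulr_sumr !sum_indic.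
by rewrite !H.
Qed.

Lemma position_along u v t d (n : int) : u \in S -> v \in S ->
  phi v = zalong d (phi u) n ->
  position (segment u v t) = along d (phi u) (t * n%:~R).
Proof.
move=> uS vS vn; rewrite position_segment // vn /zalong /along.
by case: d {vn} => /=; rewrite intrD; congr pair; ring.
Qed.

(** Testing whether the position lies on the grid gives a total map without choosing an edge for
    each point. For a drawing the test succeeds at every point, because edges are drawn along grid
    lines. *)
Definition drawing_map (x : realization R V G) : realization R (int * int) Z2 :=
  if pselect (is_point Z2 (hat (position (point_coord x)))) is left h
  then Point h else lattice_point R (0, 0).

Lemma drawing_mapE x y : hat (position (point_coord x)) = point_coord y ->
  drawing_map x = y.
Proof.
move=> e; rewrite /drawing_map; case: pselect => [h|[]]; first exact: point_inj.
by rewrite e; exact: point_coordP.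
Qed.

Lemma drawing_map_segment x u v t d (n : int) : u \in S -> v \in S ->
  phi v = zalong d (phi u) n -> point_coord x = segment u v t ->
  drawing_map x = grid_point d (phi u) (t * n%:~R).
Proof.
move=> uS vS vn xt; apply: drawing_mapE.
by rewrite xt (position_along _ uS vS vn).
Qed.

Lemma zalong0 d p : zalong d p 0 = p.
Proof. by rewrite /zalong !addr0; case: p d => ? ? []. Qed.

Lemma drawing_map_vertex x v : v \in S -> point_coord x = \1_[set v] ->
  drawing_map x = lattice_point R (phi v).
Proof.
move=> vS xv; rewrite -[in RHS](zalong0 true (phi v)) -grid_point_int.
rewrite (@drawing_map_segment x v v 0 true 0) ?zalong0 ?mul0r //.
by rewrite xv segment0.
Qed.

Lemma adj_S u v : adj G u v -> u \in S /\ v \in S.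
Proof.
move=> h; have := adj_vertices h; have := adj_vertices (adj_sym h).
by rewrite GS /= => ? ?.
Qed.

Lemma adj_phi u v : adj G u v -> aligned (phi u) (phi v) /\ phi u != phi v.
Proof.
move=> h; have [uS vS] := adj_S h.
have [[Ev ->]|[Eu ->]] := adj_par h.
  by split; [apply: (drawing_aligned D)|apply: (drawing_neq D)].
rewrite eq_sym /aligned ![_ == (phi (par u)).1]eq_sym.
rewrite ![_ == (phi (par u)).2]eq_sym.
by split; [apply: (drawing_aligned D)|apply: (drawing_neq D)].
Qed.

Lemma edges_along e : edges G e -> exists u v d (n : nat),
  [/\ adj G u v, e = [set u; v], (0 < n)%N & phi v = zalong d (phi u) n].
Proof.
case=> u [v [uv ->]]; have [al ne] := adj_phi uv.
have [d [n [n0 [h|h]]]] := aligned_zalong al ne; first by exists u, v, d, n.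
by exists v, u, d, n; split=> //; [exact: adj_sym|rewrite setUC].
Qed.

Lemma edge_image u v d (n : nat) : adj G u v -> (0 < n)%N ->
  phi v = zalong d (phi u) n ->
  drawing_map @` closed_edge R V G [set u; v] =
  [set grid_point d (phi u) s | s in `[0, n%:R : R]].
Proof.
move=> uv n0 vn; have [uS vS] := adj_S uv.
have n0R : (0 : R) < n%:R by rewrite ltr0n.
apply/seteqP; split=> y.
  case=> x /(closed_edgeP _ uv)[t /andP[t0 t1] xt] <-.
  exists (t * n%:R); last by rewrite (drawing_map_segment uS vS vn xt).
  by rewrite /= in_itv /= mulr_ge0 //= ler_piMl.
case=> s; rewrite /= in_itv /= => /andP[s0 sn] <-.
have h : 0 <= s / n%:R <= 1 by rewrite divr_ge0 //= ler_pdivrMr // mul1r.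
have xt : point_coord (edge_point uv (s / n%:R)) = segment u v (s / n%:R).
  by rewrite /= clamp_id.
exists (edge_point uv (s / n%:R)).
  by apply/(closed_edgeP _ uv); exists (s / n%:R).
by rewrite (drawing_map_segment uS vS vn xt) -pmulrn divfK ?gt_eqF.
Qed.

(** In the weak topology it suffices to consider characteristic maps, and on an edge the drawing is
    a grid line traversed at constant speed. *)
Lemma drawing_map_continuous : continuous drawing_map.
Proof.
apply/continuousP => U oU; suff : complex_open (drawing_map @^-1` U) by [].
move=> u v h; have [uS vS] := adj_S h; have [al ne] := adj_phi h.
(* The orientation of the edge is prescribed here, so the speed [n] may be negative. *)
have [d [n phiv]] : exists d (n : int), phi v = zalong d (phi u) n.
  have [d [n [_ [e|e]]]] := aligned_zalong al ne; first by exists d, n.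
  exists d, (- n%:Z); rewrite e /zalong; case: (phi v) d {e} => ? ? [] /=;
  by congr pair; lia.
have -> : edge_point h @^-1` (drawing_map @^-1` U) =
    (fun t => clamp t * n%:~R) @^-1` (grid_point d (phi u) @^-1` U).
  apply/seteqP; split=> t /=;
  by rewrite (drawing_map_segment uS vS phiv
       (erefl : point_coord (edge_point h t) = segment u v (clamp t))).
apply: open_comp => [t _|]; last by move/continuousP: (@grid_point_continuous R d (phi u)); apply.
by apply: continuousM; [exact: clamp_continuous|exact: cst_continuous].
Qed.

Lemma drawing_map_wiring : wiring drawing_map.
Proof.
split; first exact: drawing_map_continuous.
  move=> _ [x [v Gv xv] <-]; exists (phi v) => //.
  by rewrite (drawing_map_vertex _ xv) //; move: Gv; rewrite GS.
move=> e /edges_along [u [v [d [n [uv -> n0 vn]]]]].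
exists [set [set zalong d (phi u) m%:Z; zalong d (phi u) (m%:Z + 1)] | m in `I_n].
  move=> _ [m _ <-]; exists (zalong d (phi u) m), (zalong d (phi u) (m%:Z + 1)).
  by split=> //; exact: Z2_adj_along.
rewrite (edge_image uv n0 vn) bigcup_image; apply/seteqP; split=> y.
  case=> s; rewrite /= in_itv /= => /andP[s0 sn] <-.
  have [m mn ms] : exists2 m : nat, (m < n)%N & m%:R <= s <= m%:R + 1.
    have [sn'|sn'] := ltP s n%:R.
      exists (Num.truncn s); last by have := truncn_itv s0; rewrite -natr1; lra.
      by rewrite -(ltr_nat R); have := truncn_itv s0; lra.
    (* The far end [s = n] belongs to the last unit edge. *)
    exists n.-1; first by rewrite prednK.
    by rewrite natr1 prednK // sn andbT (le_trans _ sn') // ler_nat leq_pred.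
  by exists m => //; rewrite closed_edge_along; exists s.
case=> m /= mn; rewrite closed_edge_along => -[s]; rewrite /= in_itv /= => h <-.
exists s => //; rewrite /= in_itv /=; move: h; rewrite -pmulrn => /andP[h1 h2].
rewrite (le_trans _ h1) ?ler0n //= (le_trans h2) // natr1 ler_nat //.
Qed.

Lemma edges_par e : edges G e -> exists2 v, E v & e = [set par v; v].
Proof.
case=> u [v [uv ->]]; have [[Ev ->]|[Eu ->]] := adj_par uv; first by exists v.
by exists u => //; rewrite setUC.
Qed.

Lemma mem_edge_image u v q : adj G u v ->
  (drawing_map @` closed_edge R V G [set u; v]) (lattice_point R q) ->
  box (phi u) (phi v) q.
Proof.
have H a b d (n : nat) : adj G a b -> (0 < n)%N -> phi b = zalong d (phi a) n ->
    (drawing_map @` closed_edge R V G [set a; b]) (lattice_point R q) ->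
    box (phi a) (phi b) q.
  move=> ab n0 bn; rewrite (edge_image ab n0 bn) => -[s]; rewrite /= in_itv /=.
  move=> h /grid_point_vertex [m sm ->]; move: h; rewrite sm pmulrn ler0z ler_int bn.
  by rewrite /box /between /zalong; case: d {bn} => /=; lia.
move=> uv; have [al ne] := adj_phi uv.
have [d [n [n0 [e|e]]]] := aligned_zalong al ne; first exact: H e.
rewrite setUC => /(H _ _ _ _ (adj_sym uv) n0 e).
by rewrite /box /between; lia.
Qed.

Lemma closed_edge_end p q : adj Z2 p q ->
  closed_edge R _ Z2 [set p; q] (lattice_point R p) /\
  closed_edge R _ Z2 [set p; q] (lattice_point R q).
Proof.
move=> pq; split; apply/(closed_edgeP _ pq).
  by exists 0; rewrite ?lexx ?ler01 // segment0.
by exists 1; rewrite ?lexx ?ler01 // segment1.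
Qed.

(** If [p] or [q] is the start of neither wire, it lies on both half-open wires and disjointness
    applies. Otherwise [p] and [q] are the starts of the two different wires, the case excluded by
    [two]. *)
Lemma wired_twice u v p q : p != q -> E u -> E v ->
  box (phi (par u)) (phi u) p -> box (phi (par u)) (phi u) q ->
  box (phi (par v)) (phi v) p -> box (phi (par v)) (phi v) q -> u = v.
Proof.
move=> pq Eu Ev up uq vp vq.
have [puS uS] := adj_S (par_adj Eu); have [pvS vS] := adj_S (par_adj Ev).
have W w r : E w -> box (phi (par w)) (phi w) r -> r != phi (par w) -> wire par E phi w r.
  by rewrite /wire => -> -> ->.
have dis r : box (phi (par u)) (phi u) r -> box (phi (par v)) (phi v) r ->
    r != phi (par u) -> r != phi (par v) -> u = v.
  by move=> ur vr nu nv; apply: (drawing_disjoint D uS vS (W u r Eu ur nu) (W v r Ev vr nv)).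
(* The start of each wire is the position of a parent and lies on the other wire. Disjointness makes
   [a] and [b] parents of each other, against [par2]. *)
have two a b x y : E a -> E b -> a \in S -> b \in S -> par a \in S -> par b \in S ->
    x != y -> x = phi (par a) -> y = phi (par b) ->
    box (phi (par a)) (phi a) y -> box (phi (par b)) (phi b) x -> False.
  move=> Ea Eb aS bS paS pbS xy xa yb ay bx.
  have wa : wire par E phi a y by apply: W => //; rewrite -xa eq_sym.
  have wb : wire par E phi b x by apply: W => //; rewrite -yb.
  have ab : par b = a.
    by apply: (drawing_disjoint D pbS aS _ wa); rewrite yb; apply: (wire_end D).
  have ba : par a = b.
    by apply: (drawing_disjoint D paS bS _ wb); rewrite xa; apply: (wire_end D).
  by have := par2 Ea; rewrite ba ab Eb eqxx => /(_ isT).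
have [pu|pu] := eqVneq p (phi (par u)); have [qv|qv] := eqVneq q (phi (par v)).
- by have := two u v p q Eu Ev uS vS puS pvS pq pu qv uq vp.
- by apply: (dis q) => //; rewrite -pu eq_sym.
- by apply: (dis p) => //; rewrite -qv.
have [pv|pv] := eqVneq p (phi (par v)); last exact: (dis p).
have [qu|qu] := eqVneq q (phi (par u)); last exact: (dis q).
have qp : q != p by rewrite eq_sym.
by have := two u v q p Eu Ev uS vS puS pvS qp qu pv up vq.
Qed.

Lemma phi_inj u v : u \in S -> v \in S -> phi u = phi v -> u = v.
Proof.
move=> uS vS uv; apply: (drawing_disjoint D uS vS (wire_end D uS)).
by rewrite uv; apply: (wire_end D).
Qed.

Lemma drawing_map_coarse k : (0 < k)%N -> coarse_wiring k drawing_map.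
Proof.
move=> k0; split; first exact: drawing_map_wiring.
  move=> y _; apply: card_le_subsingleton => // x x' [[v Gv xv] <-] [[v' Gv' xv']].
  have vS : v \in S by move: Gv; rewrite GS.
  have vS' : v' \in S by move: Gv'; rewrite GS.
  rewrite (drawing_map_vertex vS xv) (drawing_map_vertex vS' xv').
  move=> /(congr1 (@point_coord _ _ _)) /indic1_inj /(phi_inj vS' vS) vv'.
  by apply: point_inj; rewrite xv xv' vv'.
move=> _ [p [q [pq ->]]]; apply: card_le_subsingleton => //.
move=> _ _ [/edges_par [u Eu ->] Hu] [/edges_par [v Ev ->] Hv].
have [cp cq] := closed_edge_end pq.
suff -> : u = v by [].
apply: (wired_twice (adj_neq pq) Eu Ev);
  by apply: mem_edge_image; [exact: par_adj|by [apply: Hu|apply: Hv]].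
Qed.

Lemma volume_drawing_map :
  (volume drawing_map <= (size S + wire_length par E S phi)%:R%:E)%E.
Proof.
have [|Q [sQ HQ]] := @wires_cover V par E phi S.
  by move=> v vS Ev; apply: (drawing_aligned D).
apply: (@le_trans _ _ (size Q)%:R%:E); last by rewrite lee_fin ler_nat.
apply: (@counting_le_size _ _ _ [seq lattice_point R q | q <- Q]); first by rewrite size_map.
move=> _ [[x _ <-] [q _ fq]] /=.
have {}fq : drawing_map x = lattice_point R q by apply: point_inj.
suff [v vS wq] : exists2 v, v \in S & wire par E phi v q.
  by rewrite fq map_f // (HQ v).
have [[v Gv xv]|[u [v [t [uv t01 xt]]]]] := point_coordP x.
  have vS : v \in S by move: Gv; rewrite GS.
  exists v => //; move: fq; rewrite (drawing_map_vertex vS xv).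
  move=> /(congr1 (@point_coord _ _ _)) /indic1_inj <-; exact: (wire_end D).
have [w Ew uvw] : exists2 w, E w & [set u; v] = [set par w; w].
  by apply: edges_par; exists u, v.
have pw := par_adj Ew; have [pwS wS] := adj_S pw.
have bq : box (phi (par w)) (phi w) q.
  apply: mem_edge_image => //; exists x => //; rewrite -uvw.
  by apply/(closed_edgeP _ uv); exists t.
(* The start of an edge is missing from its half-open wire, but it is the end of the wire of the
   parent. *)
have [qw|qw] := eqVneq q (phi (par w)).
  by exists (par w) => //; rewrite qw; apply: (wire_end D).
by exists w => //; rewrite /wire Ew bq qw.
Qed.

End DrawingWiring.

(** * The linear upper bound for finite subgraphs of the tree *)

Lemma size_card_le (T : choiceType) (A : set T) (s : seq T) n : uniq s ->
  (forall a, a \in s -> A a) -> (A #<= `I_n)%card -> (size s <= n)%N.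
Proof.
move=> us sA An; have fA := card_le_finite An (finite_II n).
apply: leq_trans (geq_card_fset_set An); apply: uniq_leq_size => // a /sA Aa.
by rewrite in_fset_set // inE.
Qed.

Lemma wir_forest_le (R : realType) (G : graph (seq 'I_3)) k n : (0 < k)%N ->
  subgraph G T3 -> (vertices G #<= `I_n)%card ->
  (wir R G Z2 k <= (4 * n)%:R%:E)%E.
Proof.
move=> k0 [sV sA] Gn.
have /finite_seqP[S' GS'] := card_le_finite Gn (finite_II n).
pose S := undup S'; have uS : uniq S := undup_uniq _.
have GS : vertices G = [set` S]%classic.
  by rewrite GS'; apply/seteqP; split=> x /=; rewrite mem_undup.
have inS v : vertices G v -> v \in S by rewrite GS.
have sS : (size S <= n)%N.
  by apply: size_card_le Gn => // a aS; rewrite GS.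
(* The parent of a word is its [behead]; [E] records which edges to parents belong to [G]. *)
pose E : pred (seq 'I_3) := fun v => (v != [::]) && `[< adj G (behead v) v >].
have Eadj v : E v -> adj G (behead v) v by case/andP=> _ /asboolP.
have [phi [D L]] : exists phi, drawing (@behead 'I_3) E S phi /\
    (wire_length (@behead 'I_3) E S phi <= 3 * size S)%N.
  apply: linear_drawing => //.
  - by move=> v vS; have : vertices G v by [rewrite GS]; move=> /sV.
  - by move=> v /Eadj h; apply/inS/(adj_vertices (adj_sym h)).
  - by move=> v /Eadj h; apply/inS/(adj_vertices h).
have adjE u v : adj G u v -> (E v /\ u = behead v) \/ (E u /\ v = behead u).
  move=> uv; have /and3P[_ _ /orP[]] := sA _ _ uv.
    case/existsP=> a /eqP va; left; subst v; split=> //.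
    by rewrite /E /=; apply/asboolP.
  case/existsP=> a /eqP ua; right; subst u; split=> //.
  by rewrite /E /=; apply/asboolP/adj_sym.
have par2 v : E v -> E (behead v) -> behead (behead v) != v.
  move=> /andP[v0 _] _; apply/eqP => /(congr1 size); rewrite !size_behead.
  by move: v0; rewrite -size_eq0; lia.
apply: (@le_trans _ _ (volume (@drawing_map R _ G S phi))).
  apply: ereal_inf_lbound; exists (@drawing_map R _ G S phi) => //.
  exact: (drawing_map_coarse R uS GS adjE Eadj par2 D).
apply: le_trans (volume_drawing_map R uS GS adjE Eadj D) _.
(* One unit per vertex and three per vertex for the wires give the constant 4. *)
by rewrite lee_fin ler_nat; lia.
Qed.

(** * The linear lower bound from edgeless subgraphs *)

Lemma size_fibers (U T : eqType) (g : U -> T) (Q : seq T) (s : seq U) k :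
  (forall x, x \in s -> g x \in Q) ->
  (forall y, y \in Q -> (count (fun x => g x == y) s <= k)%N) ->
  (size s <= k * size Q)%N.
Proof.
elim: Q s => [|y Q IH] s sQ Hk.
  by case: s sQ {Hk} => // x s /(_ x (mem_head _ _)).
(* The fibre over [y] has at most [k] elements, and the rest of [s] maps into [Q]. *)
rewrite -(count_predC (fun x => g x == y)) /= mulnS leq_add ?Hk ?mem_head //.
rewrite -size_filter; apply: IH => [x|z zQ].
  by rewrite mem_filter /= => /andP[xy /sQ]; rewrite inE (negbTE xy).
apply: leq_trans (Hk z _); last by rewrite inE zQ orbT.
by rewrite count_filter; apply: sub_count => x /= /andP[].
Qed.

(** Alternating two letters gives a reduced word of every length, hence arbitrarily many vertices of
    the tree. *)
Fixpoint zigzag (m : nat) : seq 'I_3 :=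
  if m is m'.+1 then (if odd m' then ord0 else ord_max) :: zigzag m' else [::].

Lemma size_zigzag m : size (zigzag m) = m.
Proof. by elim: m => //= m ->. Qed.

Lemma reduced_zigzag m : reduced (zigzag m).
Proof.
elim: m => // -[|m] //=; rewrite /reduced /= => ->.
by rewrite andbT; case: (odd m).
Qed.

Definition edgeless (n : nat) : graph (seq 'I_3) :=
  @Graph _ [set v | exists i : 'I_n, v = zigzag i]%classic (fun _ _ => False)
    (fun _ _ h => h) (fun _ h => h) (fun _ _ => False_ind _).

(** All [n] vertices are sent to lattice vertices in the image, at most [k] of them to each. *)
Lemma wir_edgeless_ge (R : realType) k n : (0 < k)%N ->
  ((n%:R / k%:R)%:E <= wir R (edgeless n) Z2 k)%E.
Proof.
move=> k0; apply: le_ereal_inf_tmp => _ [f [[_ fV _] fk _] <-].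
rewrite /volume /counting; case: asboolP => [fin|_]; last by rewrite leey.
rewrite lee_fin ler_pdivrMr ?ltr0n // -natrM ler_nat mulnC.
have ptP (i : 'I_n) : is_point (edgeless n) (\1_[set zigzag i] : _ -> R).
  by left; exists (zigzag i) => //; exists i.
pose pt i : realization R _ (edgeless n) := Point (ptP i).
have pt_inj : injective pt.
  move=> i j /(congr1 (@point_coord _ _ _)) /= /indic1_inj /(congr1 size).
  by rewrite !size_zigzag => /val_inj.
have ptV i : vertex_points R _ (edgeless n) (pt i).
  by exists (zigzag i) => //; exists i.
rewrite -[X in (X <= _)%N](size_enum_ord n).
apply: (@size_fibers _ _ (f \o pt)) => [i _|y].
  by rewrite in_fset_set // inE; split; [exists (pt i)|apply: fV; exists (pt i)].
rewrite in_fset_set // inE => -[_ yV].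
rewrite -size_filter -(size_map pt); apply: size_card_le (fk y yV).
  by rewrite map_inj_uniq // filter_uniq // enum_uniq.
by move=> _ /mapP[i + ->]; rewrite mem_filter => /andP[/eqP ? _].
Qed.

Theorem theorem1p0p3 (R : realType) (k : nat) (hk : (1 <= k)%N) :
  asymp_eq (wiring_profile R T3 Z2 k) (fun n : nat => n%:R%:E).
Proof.
split.
  exists 4%N => n; apply: ge_ereal_sup => _ [G [sG Gn] <-].
  apply: le_trans (wir_forest_le R hk sG Gn) _.
  by rewrite -EFinM -EFinD lee_fin -natrM -natrD ler_nat; lia.
(* The factor [k] cancels the division by [k] in the lower bound, and [n <= k * n] makes the
   edgeless graph admissible at the dilated argument. *)
exists k => n; have k0 : (0 : R) < k%:R by rewrite ltr0n.
have H : ((n%:R / k%:R)%:E <= wiring_profile R T3 Z2 k (k * n))%E.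
  apply: le_trans (wir_edgeless_ge R n hk) _.
  apply: ereal_sup_ubound; exists (edgeless n) => //; split.
    by split=> // _ [i ->]; exact: reduced_zigzag.
  apply: (@card_le_trans _ _ _ `I_n); last by rewrite card_le_II leq_pmull.
  have -> : vertices (edgeless n) = (zigzag @` `I_n)%classic.
    apply/seteqP; split=> v.
      by case=> i ->; exists (i : nat) => //=.
    by case=> i /= ilt <-; exists (Ordinal ilt).
  exact: card_image_le.
apply: (@le_trans _ _ (k%:R%:E * wiring_profile R T3 Z2 k (k * n)%N)%E); last first.
  by rewrite leeDl // lee_fin.
rewrite -[X in (X <= _)%E](_ : k%:R%:E * (n%:R / k%:R)%:E = _)%E.
  by rewrite lee_pmul2l.
by rewrite -EFinM mulrC divfK // gt_eqF.
Qed.
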